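(* Let $(M,\omega)$ be a connected symplectic manifold equipped with commuting hamiltonian proper actions of connected Lie groups $G_1$ and $G_2$, with equivariant moment maps $\Phi_1:M\to\mathfrak g_1^*$ and $\Phi_2:M\to\mathfrak g_2^*$. Then the symplectic Howe condition $$Z_{C^\infty(M)}(\Phi_i^*C^\infty(\mathfrak g_i^* ))=\Phi_j^*C^\infty(\mathfrak g_j^* )\qquad\text{for } i\neq j,\ i,j\in\{1,2\}$$ implies that for all $z\in M$ $$\Phi_i^{-1}(\Phi_i(z))=G_j\cdot z\qquad\text{for } i\neq j,$$ i.e. the level sets of the moment map of one action are the orbits of the other one.
   Context: For $\xi\in\mathfrak g_i$ (the Lie algebra of $G_i$), $\tau_i(\xi)$ is the fundamental vector field on $M$. Hamiltonian action with equivariant moment map: $d\Phi_i^\xi=\omega(\tau_i(\xi),\cdot)$ for all $\xi\in\mathfrak g_i$, where $\Phi_i^\xi=\langle\Phi_i,\xi\rangle$, and $\Phi_i(g\cdot z)=\mathrm{Ad}^*(g)\Phi_i(z)$ for all $g\in G_i$, $z\in M$. The hamiltonian vector field $X_f$ of $f\in C^\infty(M)$ is defined by $\omega(X_f,\cdot)=df$, and $\{f,h\}=\omega(X_f,X_h)$. For $A\subseteq C^\infty(M)$, $Z_{C^\infty(M)}(A)=\{f\in C^\infty(M)\mid\{f,a\}=0\ \forall a\in A\}$. $\Phi_i^*C^\infty(\mathfrak g_i^* )=\{h\circ\Phi_i\mid h\in C^\infty(\mathfrak g_i^* )\}$. *)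

(* Defs.v *)
From HB Require Import structures.
From mathcomp Require Import all_boot all_order all_algebra.
From mathcomp Require Import all_classical all_reals all_analysis.

Set Implicit Arguments.
Unset Strict Implicit.
Unset Printing Implicit Defensive.

Import Order.TTheory GRing.Theory Num.Theory.
Import numFieldNormedType.Exports.

Local Open Scope classical_set_scope.
Local Open Scope ring_scope.

(* [Ck k U f] is the usual C^k condition when [U] is open, the only case in
   which it is used below; ['D_v f x] then depends on [f] only near [x]. *)
Fixpoint Ck (R : realType) (V W : normedModType R) (k : nat) (U : set V)
    (f : V -> W) : Prop :=
  match k with
  | 0%N => forall x, U x -> {for x, continuous f}
  | j.+1 => (forall x, U x -> differentiable f x) /\
            (forall v : V, Ck j U (fun x => 'D_v f x))
  end.

Definition smooth_on (R : realType) (V W : normedModType R) (U : set V)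
  (f : V -> W) : Prop := forall k, Ck k U f.

(* A homeomorphism [chart_map] from the open set [chart_dom] of [M] onto the
   open set [chart_cod] of R^n, with inverse [chart_inv]; the values of
   [chart_map] outside [chart_dom] and of [chart_inv] outside [chart_cod] are
   irrelevant. *)
Record chart (R : realType) (n : nat) (M : topologicalType) := Chart {
  chart_dom : set M;
  chart_cod : set 'rV[R]_n;
  chart_map : M -> 'rV[R]_n;
  chart_inv : 'rV[R]_n -> M;
  chart_dom_open : open chart_dom;
  chart_cod_open : open chart_cod;
  chart_map_cod : forall p, chart_dom p -> chart_cod (chart_map p);
  chart_inv_dom : forall x, chart_cod x -> chart_dom (chart_inv x);
  chart_mapK : forall p, chart_dom p -> chart_inv (chart_map p) = p;
  chart_invK : forall x, chart_cod x -> chart_map (chart_inv x) = x;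
  chart_map_continuous : {within chart_dom, continuous chart_map};
  chart_inv_continuous : {within chart_cod, continuous chart_inv} }.

(* Smooth manifolds of dimension [n]: Hausdorff, second countable, with a
   smooth atlas.  [chart_at] selects, for each point, a chart of the atlas
   around it; it only serves to represent tangent vectors by coordinates. *)
HB.mixin Record Topological_isManifold (R : realType) (n : nat) M
    of Topological M := {
  atlas : set (chart R n M);
  chart_at : M -> chart R n M;
  chart_at_atlas : forall p : M, atlas (chart_at p);
  chart_at_dom : forall p : M, chart_dom (chart_at p) p;
  atlas_compatible : forall c d : chart R n M, atlas c -> atlas d ->
    smooth_on (chart_cod c `&` chart_inv c @^-1` chart_dom d)
              (chart_map d \o chart_inv c);
  manifold_hausdorff : hausdorff_space M;
  manifold_second_countable : @second_countable M }.

#[short(type="manifoldType")]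
HB.structure Definition Manifold (R : realType) (n : nat) :=
  {M of Topological_isManifold R n M & Topological M}.

Definition smooth_map (R : realType) (m n : nat) (M : manifoldType R m)
    (N : manifoldType R n) (f : M -> N) : Prop :=
  continuous f /\
  forall (c : chart R m M) (d : chart R n N), atlas c -> atlas d ->
    smooth_on (chart_cod c `&` (f \o chart_inv c) @^-1` chart_dom d)
              (chart_map d \o f \o chart_inv c).

(* Smoothness of M1 x M2 -> N for the product smooth structure, whose charts
   are the products c1 x c2, with R^m1 x R^m2 written as R^(m1 + m2). *)
Definition smooth_map2 (R : realType) (m1 m2 n : nat) (M1 : manifoldType R m1)
    (M2 : manifoldType R m2) (N : manifoldType R n) (f : M1 -> M2 -> N) :
    Prop :=
  continuous (fun p : M1 * M2 => f p.1 p.2) /\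
  forall (c1 : chart R m1 M1) (c2 : chart R m2 M2) (d : chart R n N),
    atlas c1 -> atlas c2 -> atlas d ->
    let F (x : 'rV[R]_(m1 + m2)) :=
      f (chart_inv c1 (lsubmx x)) (chart_inv c2 (rsubmx x)) in
    smooth_on [set x | [/\ chart_cod c1 (lsubmx x), chart_cod c2 (rsubmx x)
                         & chart_dom d (F x)]]
              (chart_map d \o F).

Definition smooth_fun (R : realType) (m : nat) (M : manifoldType R m)
    (W : normedModType R) (f : M -> W) : Prop :=
  forall c : chart R m M, atlas c -> smooth_on (chart_cod c) (f \o chart_inv c).

(* A tangent vector at [p] is represented by its coordinates in the chart
   [chart_at p]. *)
Definition tangent (R : realType) (n : nat) (M : manifoldType R n) (p : M) :=
  'rV[R]_n.

Definition tangent_map (R : realType) (m n : nat) (M : manifoldType R m)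
    (N : manifoldType R n) (f : M -> N) (p : M) (v : tangent p) :
    tangent (f p) :=
  'D_v (chart_map (chart_at (f p)) \o f \o chart_inv (chart_at p))
       (chart_map (chart_at p) p).
Arguments tangent_map {R m n M N} f p v.

Definition dfun (R : realType) (m : nat) (M : manifoldType R m)
    (W : normedModType R) (f : M -> W) (p : M) (v : tangent p) : W :=
  'D_v (f \o chart_inv (chart_at p)) (chart_map (chart_at p) p).
Arguments dfun {R m M W} f p v.

Definition bilinear_field (R : realType) (n : nat) (M : manifoldType R n) :=
  forall p : M, tangent p -> tangent p -> R.

(* The coordinate expression of [omega] in the chart [c]: the pullback of
   [omega] along [chart_inv c], at [x], evaluated on [u] and [v]. *)
Definition local_form (R : realType) (n : nat) (M : manifoldType R n)
    (omega : bilinear_field M) (c : chart R n M) (u v x : 'rV[R]_n) : R :=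
  let T w := 'D_w (chart_map (chart_at (chart_inv c x)) \o chart_inv c) x in
  omega (chart_inv c x) (T u) (T v).

(* [symplectic_closed] is d omega = 0: for constant vector fields u, v, w on an
   open subset of R^n, d omega (u, v, w) is the cyclic sum below. *)
Record symplectic_form (R : realType) (n : nat) (M : manifoldType R n)
    (omega : bilinear_field M) : Prop := {
  symplectic_linear_l : forall (p : M) (v : tangent p), scalar (omega p ^~ v);
  symplectic_linear_r : forall (p : M) (u : tangent p), scalar (omega p u);
  symplectic_alternating : forall (p : M) (u : tangent p), omega p u u = 0;
  symplectic_nondegenerate : forall (p : M) (u : tangent p),
    (forall v : tangent p, omega p u v = 0) -> u = 0;
  symplectic_smooth : forall c : chart R n M, atlas c ->
    forall u v : 'rV[R]_n, smooth_on (chart_cod c) (local_form omega c u v);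
  symplectic_closed : forall c : chart R n M, atlas c ->
    forall (u v w x : 'rV[R]_n), chart_cod c x ->
      'D_u (local_form omega c v w) x + 'D_v (local_form omega c w u) x
      + 'D_w (local_form omega c u v) x = 0 }.

(* X_f at [p]; for a symplectic [omega] and a smooth [f] the set below is a
   singleton. *)
Definition hamiltonian_vf (R : realType) (n : nat) (M : manifoldType R n)
    (omega : bilinear_field M) (f : M -> R) (p : M) : tangent p :=
  xget 0 [set X : 'rV[R]_n | forall v : tangent p, omega p X v = dfun f p v].

Definition poisson (R : realType) (n : nat) (M : manifoldType R n)
    (omega : bilinear_field M) (f h : M -> R) (p : M) : R :=
  omega p (hamiltonian_vf omega f p) (hamiltonian_vf omega h p).

Definition centralizer (R : realType) (n : nat) (M : manifoldType R n)
    (omega : bilinear_field M) (A : set (M -> R)) : set (M -> R) :=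
  [set f | smooth_fun f /\ forall a, A a -> forall p, poisson omega f a p = 0].

HB.mixin Record Manifold_isLieGroup (R : realType) (n : nat) G
    of Manifold R n G & Group G := {
  mulg_smooth : smooth_map2 (fun x y : G => (x * y)%g);
  invg_smooth : smooth_map (fun x : G => (x^-1)%g) }.

#[short(type="lieGroupType")]
HB.structure Definition LieGroup (R : realType) (n : nat) :=
  {G of Manifold_isLieGroup R n G & Manifold R n G & Group G}.

(* The Lie algebra is T_1 G; only its vector space structure is needed. *)
Definition lie (R : realType) (m : nat) (G : lieGroupType R m) :=
  tangent (1%g : G).

(* The dual of the space 'rV_m of row vectors is the space 'cV_m of column
   vectors, through [pairing]. *)
Definition lie_dual (R : realType) (m : nat) (G : lieGroupType R m) :=
  'cV[R]_m.

Definition pairing (R : realType) (m : nat) (alpha : 'cV[R]_m)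
    (xi : 'rV[R]_m) : R := (xi *m alpha) 0 0.

(* Ad(g) is the tangent map at 1 of conjugation h |-> g h g^-1.  It has values
   in the tangent space at g 1 g^-1, which is 1 only up to a propositional
   equality. *)
Definition Ad (R : realType) (m : nat) (G : lieGroupType R m) (g : G)
    (xi : lie G) : lie G :=
  tangent_map (fun h : G => (g * h * g^-1)%g) 1%g xi.

(* <Ad^*(g) alpha, xi> = <alpha, Ad(g^-1) xi>, so that Ad^* is a left action;
   a vector of the dual is given by its values on the basis of [lie G]. *)
Definition coAd (R : realType) (m : nat) (G : lieGroupType R m) (g : G)
    (alpha : lie_dual G) : lie_dual G :=
  \col_i pairing alpha (Ad (g^-1)%g (delta_mx 0 i : lie G)).

Record smooth_action (R : realType) (m n : nat) (G : lieGroupType R m)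
    (M : manifoldType R n) (a : G -> M -> M) : Prop := {
  smooth_act1 : forall z : M, a 1%g z = z;
  smooth_actM : forall (g h : G) (z : M), a (g * h)%g z = a g (a h z);
  smooth_act_smooth : smooth_map2 a }.

(* The map (g, z) |-> (g z, z) is proper. *)
Definition proper_action (R : realType) (m n : nat) (G : lieGroupType R m)
    (M : manifoldType R n) (a : G -> M -> M) : Prop :=
  forall K : set (M * M), compact K ->
    compact [set x : G * M | K (a x.1 x.2, x.2)].

(* The fundamental vector field z |-> d/dt exp(t xi) z at t = 0, i.e. the
   tangent map at 1 of the orbit map g |-> g z applied to [xi]. *)
Definition fundamental_vf (R : realType) (m n : nat) (G : lieGroupType R m)
    (M : manifoldType R n) (a : G -> M -> M) (xi : lie G) (z : M) : tangent z :=
  tangent_map (a ^~ z) 1%g xi.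

Record equivariant_moment_map (R : realType) (m n : nat)
    (G : lieGroupType R m) (M : manifoldType R n) (omega : bilinear_field M)
    (a : G -> M -> M) (Phi : M -> lie_dual G) : Prop := {
  moment_smooth : smooth_fun (Phi : M -> 'cV[R]_m);
  moment_differential : forall (xi : lie G) (z : M) (v : tangent z),
    dfun (fun y => pairing (Phi y) xi) z v = omega z (fundamental_vf a xi z) v;
  moment_equivariant : forall (g : G) (z : M), Phi (a g z) = coAd g (Phi z) }.

Definition moment_pullback (R : realType) (m n : nat) (G : lieGroupType R m)
    (M : manifoldType R n) (Phi : M -> lie_dual G) : set (M -> R) :=
  [set h \o Phi | h in [set h : 'cV[R]_m -> R | smooth_on setT h]].

Definition action_orbit (R : realType) (m n : nat) (G : lieGroupType R m)
    (M : manifoldType R n) (a : G -> M -> M) (z : M) : set M :=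
  range (a ^~ z).

(* Main.v *)
Require Import Defs.
From HB Require Import structures.
From mathcomp Require Import all_boot all_order all_algebra.
From mathcomp Require Import all_classical all_reals all_analysis.
From mathcomp Require Import ring lra.

(* [Phi1] is constant on the [G2]-orbits: by the Howe condition the components
   of [Phi1] and [Phi2] Poisson commute, so those of [Phi1] have zero derivative
   along the fundamental vector fields of [G2], and [G2] is connected.
   Conversely, a [G2]-invariant smooth function commutes with every function of
   [Phi2], hence is of the form [h \o Phi1] and cannot separate two points of a
   level set of [Phi1].  But invariant smooth functions separate the orbits of a
   proper action: orbits are closed, and the average over the group of a smooth
   bump function supported near [z] and away from the orbit of [w] is invariant,
   positive at [z] and zero at [w].
     The average is taken against an invariant positive linear functional on the
   continuous functions with compact support, obtained by Weil's construction as
   a limit of covering numbers along an ultrafilter; its invariance, linearity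
   and boundedness for uniform convergence on compact sets are all that is
     needed
   to differentiate the average in the parameter. *)

Set Implicit Arguments.
Unset Strict Implicit.
Unset Printing Implicit Defensive.

Import Order.TTheory GRing.Theory Num.Theory.
Import numFieldNormedType.Exports.
Local Open Scope classical_set_scope.
Local Open Scope ring_scope.

(** * Invariant functionals on a Lie group *)

(** The group is not assumed compact, so averaging makes sense only because properness confines the
    elements [g] that move a given point into the support of the bump to a compact set, the same one
    for all nearby points. The integrand at [h z] is a right translate of the integrand at [z],
    hence the functional has to be right invariant. Its existence is hard only in one respect:
    covering numbers are monotone, homogeneous and invariant, but merely subadditive. The reverse
    inequality holds up to a factor [1 + e] once [phi] is concentrated near 1, so additivity appears
    only in the limit. An ultrafilter makes the limits exist for all functions at once. The average
    must be differentiated in the point and never in the group variable; a parameter-dependent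
    notion of C^k, asking only continuity in the parameter, is therefore the natural one. *)

Lemma compact_set_ind (T : topologicalType) (K : set T) (Q : set T -> Prop) :
  compact K -> Q set0 ->
  (forall A B, A `<=` B -> Q B -> Q A) ->
  (forall A B, Q A -> Q B -> Q (A `|` B)) ->
  (forall x, K x -> exists2 U, nbhs x U & Q U) -> Q K.
Proof.
move=> /compact_near_coveringP cK Q0 Qsub QU Qloc.
(* Members of [F] contain all supersets of some set satisfying [Q]. That [K] lies in almost every
   set for [F] then says that [K] lies in a set satisfying [Q], and the near-covering form of
   compactness reduces this to a local check. *)
pose F : set_system (set T) :=
  [set P | exists2 A, Q A & forall B, A `<=` B -> P B].
have FF : Filter F.
  split.
  - by exists set0.
  - move=> P P' [A QA AP] [B QB BP]; exists (A `|` B); first exact: QU.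
    by move=> C ABC; split; [apply: AP|apply: BP] => x Hx; apply: ABC;
      [left|right].
  - by move=> P P' PP' [A QA AP]; exists A => // B /AP /PP'.
have [A QA AK] : \forall A \near F, K `<=` A.
  apply: (cK _ F (fun A x => A x)) => x /Qloc [U xU QU'].
  exists (U, [set A | U `<=` A]); first by split=> //=; exists U.
  by move=> [y A] /= [Uy UA]; apply: UA.
by apply: (Qsub _ A) => //; exact: AK.
Qed.

(** * Weil's covering numbers *)

Section Haar.
Context {R : realType} {m : nat} {G : lieGroupType R m}.
Implicit Types (f g phi psi : G -> R) (K : set G).

Lemma mulg_continuous : continuous (fun p : G * G => (p.1 * p.2)%g).
Proof. by case: (@mulg_smooth R m G). Qed.

Lemma mulgr_continuous (h : G) : continuous (fun x : G => (x * h)%g).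
Proof.
move=> x; apply: (@continuous_comp _ _ _ (fun x : G => (x, h))
  (fun p : G * G => (p.1 * p.2)%g)); last exact: mulg_continuous.
by apply: cvg_pair => /=; [exact: cvg_id|exact: cvg_cst].
Qed.

Lemma invg_continuous : continuous (fun x : G => (x^-1)%g).
Proof. by case: (@invg_smooth R m G). Qed.

Definition vanishes_off K f := forall x, ~ K x -> f x = 0.

Definition Cc f := continuous f /\ exists2 K, compact K & vanishes_off K f.
Definition Cc_nneg f := Cc f /\ forall x, 0 <= f x.

Definition comb phi (cs : seq (R * G)) (x : G) : R :=
  \sum_(p <- cs) p.1 * phi (x * p.2)%g.
Definition wt (cs : seq (R * G)) : R := \sum_(p <- cs) p.1.
Definition nneg_coefs (cs : seq (R * G)) := all (fun p => 0 <= p.1) cs.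
Definition dominates phi f cs :=
  nneg_coefs cs /\ forall x, f x <= comb phi cs x.

(* Weil's covering number [(f : phi)]: the least total weight of a combination
   of translates of [phi] dominating [f]. *)
Definition cov phi f : R := inf [set wt cs | cs in dominates phi f].

Lemma wt_ge0 cs : nneg_coefs cs -> 0 <= wt cs.
Proof. by move=> /allP h; rewrite /wt big_seq sumr_ge0. Qed.

Lemma comb_ge0 phi cs x : (forall x, 0 <= phi x) -> nneg_coefs cs ->
  0 <= comb phi cs x.
Proof.
by move=> p0 /allP h; rewrite /comb big_seq sumr_ge0 // => p /h ?;
  exact: mulr_ge0.
Qed.

Lemma Cc_bounded f : Cc f -> exists2 B : R, 0 < B & forall x, `|f x| <= B.
Proof.
move=> [cf [K cK fK]].
have [B B0 hB] : exists2 B : R, 0 < B & forall x, K x -> `|f x| <= B.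
  apply: (compact_set_ind cK (Q :=
    fun A => exists2 B : R, 0 < B & forall x, A x -> `|f x| <= B)).
  - by exists 1.
  - by move=> A B AB [b b0 hb]; exists b => // x /AB /hb.
  - move=> A A' [b b0 hb] [b' b0' hb']; exists (b + b'); first exact: addr_gt0.
    move=> x [/hb|/hb'] h; apply: (le_trans h).
      by rewrite lerDl ltW.
    by rewrite lerDr ltW.
  - move=> x _; exists [set y | `|f y - f x| < 1].
      have /cvgrPdist_lt /(_ 1 ltr01) := cf x.
      by apply: filterS => y; rewrite /= distrC.
    exists (1 + `|f x|); first by rewrite ltr_wpDr.
    move=> y /= h; rewrite -[f y](subrK (f x)).
    by apply: (le_trans (ler_normD _ _)); rewrite lerD2r ltW.
exists B => // x; have [/hB//|/fK ->] := pselect (K x).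
by rewrite normr0 ltW.
Qed.

Lemma comb_cat phi cs ds x :
  comb phi (cs ++ ds) x = comb phi cs x + comb phi ds x.
Proof. by rewrite /comb big_cat. Qed.

Lemma wt_cat cs ds : wt (cs ++ ds) = wt cs + wt ds.
Proof. by rewrite /wt big_cat. Qed.

(** Near [x] a single translate is enough: the one that carries the value [phi x0] to [x], scaled to
    take the value [|f x| + 1] there. Concatenating finitely many such combinations preserves
    domination because all terms are nonnegative. *)
Lemma translates_dominate_compact phi f K (x0 : G) :
  Cc_nneg phi -> 0 < phi x0 -> continuous f -> compact K ->
  exists2 cs, nneg_coefs cs & forall x, K x -> f x < comb phi cs x.
Proof.
move=> [[cphi _] p0] px0 cf cK.
apply: (compact_set_ind cK (Q :=
  fun A => exists2 cs, nneg_coefs cs & forall x, A x -> f x < comb phi cs x)).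
- by exists [::].
- by move=> A B AB [cs ? h]; exists cs => // x /AB /h.
- move=> A B [cs ncs hcs] [ds nds hds]; exists (cs ++ ds).
    by rewrite /nneg_coefs all_cat; apply/andP.
  move=> x [/hcs|/hds] h; rewrite comb_cat; apply: (lt_le_trans h).
    by rewrite lerDl comb_ge0.
  by rewrite lerDr comb_ge0.
- move=> x _; pose h := (x^-1 * x0)%g; pose c := (`|f x| + 1) / phi x0.
  have c0 : 0 <= c by rewrite divr_ge0 ?addr_ge0 // ltW.
  exists [set y | f y < c * phi (y * h)%g]; last first.
    exists [:: (c, h)]; first by rewrite /nneg_coefs /= c0.
    by move=> y; rewrite /comb big_seq1.
  have cont : {for x, continuous (fun y => c * phi (y * h)%g - f y)}.
    apply: cvgB; last exact: cf.
    apply: cvgM; first exact: cvg_cst.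
    apply: (@continuous_comp _ _ _ (fun y : G => (y * h)%g) phi).
      exact: mulgr_continuous.
    exact: cphi.
  have pos : 0 < c * phi (x * h)%g - f x.
    rewrite /h mulgA mulgV mul1g /c divfK ?gt_eqF // subr_gt0.
    by rewrite ltr_pwDr ?ler_norm.
  have near_pos : \forall y \near x, 0 < c * phi (y * h)%g - f y.
    exact: (cvgr_gt _ cont _ pos).
  by apply: filterS near_pos => y; rewrite subr_gt0.
Qed.

Lemma dominates_nonempty phi f (x0 : G) : Cc_nneg phi -> 0 < phi x0 -> Cc f ->
  exists cs, dominates phi f cs.
Proof.
move=> cp px0 [cf [K cK fK]].
have [cs ncs h] := translates_dominate_compact cp px0 cf cK.
exists cs; split=> // x; have [/h/ltW//|/fK ->] := pselect (K x).
by apply: comb_ge0 => //; case: cp.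
Qed.

Lemma cov_le_wt phi f cs : dominates phi f cs -> cov phi f <= wt cs.
Proof.
move=> h; apply: ge_inf; last by exists cs.
by exists 0 => _ [ds [nds _] <-]; exact: wt_ge0.
Qed.

Section fixed_bump.
Variables (phi : G -> R) (x0 : G).
Hypotheses (cphi : Cc_nneg phi) (px0 : 0 < phi x0).

Lemma le_cov f y : Cc f -> (forall cs, dominates phi f cs -> y <= wt cs) ->
  y <= cov phi f.
Proof.
move=> cf h; apply: lb_le_inf.
  by have [cs ?] := dominates_nonempty cphi px0 cf; exists (wt cs); exists cs.
by move=> _ [cs /h ? <-].
Qed.

Lemma cov_ge0 f : Cc f -> 0 <= cov phi f.
Proof. by move=> cf; apply: le_cov => // cs [/wt_ge0]. Qed.

Lemma le_mul_cov f a y : Cc f -> 0 <= a ->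
  (forall cs, dominates phi f cs -> y <= a * wt cs) -> y <= a * cov phi f.
Proof.
move=> cf age0 h; have [a_eq0|an0] := eqVneq a 0.
  rewrite a_eq0 in h *; have [cs /h] := dominates_nonempty cphi px0 cf.
  by rewrite !mul0r.
have a0 : 0 < a by rewrite lt_def an0.
rewrite mulrC -ler_pdivrMr //; apply: le_cov => // cs /h.
by rewrite ler_pdivrMr // mulrC.
Qed.

Lemma cov_subadd f g : Cc f -> Cc g ->
  cov phi (f \+ g) <= cov phi f + cov phi g.
Proof.
move=> cf cg; rewrite -lerBlDr; apply: le_cov => // cs [ncs hcs].
rewrite lerBlDr addrC -lerBlDr; apply: le_cov => // ds [nds hds].
rewrite lerBlDr -wt_cat; apply: cov_le_wt; split.
  by rewrite /nneg_coefs all_cat; apply/andP.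
by move=> x; rewrite comb_cat addrC lerD.
Qed.

Lemma Cc_scale c f : Cc f -> Cc (fun x => c * f x).
Proof.
move=> [cf [K cK fK]]; split.
  by move=> x; apply: cvgM; [exact: cvg_cst|exact: cf].
by exists K => // x /fK ->; rewrite mulr0.
Qed.

Lemma Cc_add f g : Cc f -> Cc g -> Cc (f \+ g).
Proof.
move=> [cf [K cK fK]] [cg [L cL gL]]; split.
  by move=> x; apply: cvgD; [exact: cf|exact: cg].
exists (K `|` L); first exact: compactU.
by move=> x /not_orP [/fK fx /gL gx]; rewrite /= fx gx addr0.
Qed.

Lemma Cc_translate h f : Cc f -> Cc (fun x => f (x * h)%g).
Proof.
move=> [cf [K cK fK]]; split.
  move=> x; apply: (@continuous_comp _ _ _ (fun y : G => (y * h)%g) f).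
    exact: mulgr_continuous.
  exact: cf.
exists [set (x * h^-1)%g | x in K].
  apply: continuous_compact => //.
  by apply: continuous_subspaceT => x; exact: mulgr_continuous.
by move=> x nK; apply: fK => Kx; apply: nK; exists (x * h)%g => //;
  rewrite mulgK.
Qed.

Lemma cov_scale_le c f : Cc f -> 0 <= c ->
  cov phi (fun x => c * f x) <= c * cov phi f.
Proof.
move=> cf c0; apply: le_mul_cov => // cs [ncs h].
pose ds := [seq (c * p.1, p.2) | p <- cs].
have -> : c * wt cs = wt ds by rewrite /wt big_map mulr_sumr.
apply: cov_le_wt; split.
  by rewrite /nneg_coefs all_map; apply: sub_all ncs => p /= ?; exact: mulr_ge0.
move=> x; have -> : comb phi ds x = c * comb phi cs x.
  by rewrite /comb big_map mulr_sumr; apply: eq_bigr => p _; rewrite mulrA.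
exact: ler_wpM2l.
Qed.

Lemma cov_scale c f : Cc f -> 0 <= c ->
  cov phi (fun x => c * f x) = c * cov phi f.
Proof.
move=> cf c0; apply/le_anti/andP; split; first exact: cov_scale_le.
have [c_eq0|cn0] := eqVneq c 0.
  by rewrite c_eq0 mul0r; apply: cov_ge0; exact: Cc_scale.
have {cn0}c_gt0 : 0 < c by rewrite lt_def cn0.
have := cov_scale_le (c := c^-1) (Cc_scale c cf).
rewrite invr_ge0 => /(_ c0).
rewrite [X in cov _ X](_ : _ = f); last by apply/funext => x;
  rewrite mulKf ?gt_eqF.
by rewrite mulrC ler_pdivlMr // mulrC.
Qed.

Lemma cov_translate_le h f : Cc f ->
  cov phi (fun x => f (x * h)%g) <= cov phi f.
Proof.
move=> cf; apply: le_cov => // cs [ncs hcs].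
pose ds := [seq (p.1, (h * p.2)%g) | p <- cs].
have -> : wt cs = wt ds by rewrite /wt big_map.
apply: cov_le_wt; split; first by rewrite /nneg_coefs all_map.
move=> x; apply: (le_trans (hcs _)).
by rewrite /comb big_map; apply: ler_sum => p _ /=; rewrite mulgA.
Qed.

Lemma cov_translate h f : Cc f -> cov phi (fun x => f (x * h)%g) = cov phi f.
Proof.
move=> cf; apply/le_anti/andP; split; first exact: cov_translate_le.
have := cov_translate_le (h^-1)%g (Cc_translate h cf).
by under [X in cov _ X <= _]eq_fun do rewrite mulgVK.
Qed.

(** If [B] bounds [phi], evaluating a dominating combination at [x] gives [f x <= B * wt cs], so
    every admissible weight is at least [f x / B]. *)
Lemma cov_gt0 f x : Cc f -> 0 < f x -> 0 < cov phi f.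
Proof.
move=> cf fx; case: (cphi) => [/Cc_bounded [B B0 hB] p0].
suff: f x / B <= cov phi f by apply: lt_le_trans; rewrite divr_gt0.
apply: le_cov => // cs [ncs h]; rewrite ler_pdivrMr //.
apply: (le_trans (h x)); rewrite /comb /wt mulr_suml !big_seq.
apply: ler_sum => p /(allP ncs) ?; apply: ler_wpM2l => //.
exact: le_trans (ler_norm _) (hB _).
Qed.

End fixed_bump.

(** Substituting a combination that dominates [psi] into one that dominates [f] multiplies the
    weights. This inequality bounds normalized covering numbers from both sides, uniformly in
    [phi]. *)
Lemma cov_comp phi psi f x0 x1 : Cc_nneg phi -> 0 < phi x0 -> Cc_nneg psi ->
  0 < psi x1 -> Cc f -> cov phi f <= cov psi f * cov phi psi.
Proof.
move=> cp p0 cs s0 cf; rewrite mulrC.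
apply: (le_mul_cov cs s0) => //; first by apply: (cov_ge0 cp p0); case: cs.
move=> ds [nds hds]; rewrite mulrC.
apply: (le_mul_cov cp p0); [by case: cs| exact: wt_ge0|].
move=> es [nes hes].
pose prod := [seq (p.1 * q.1, (p.2 * q.2)%g) | p <- ds, q <- es].
have sumE (F : R * G -> R) : \sum_(r <- prod) F r =
    \sum_(p <- ds) \sum_(q <- es) F (p.1 * q.1, (p.2 * q.2)%g).
  by rewrite /prod big_allpairs_dep.
have -> : wt ds * wt es = wt prod.
  by rewrite {3}/wt sumE /wt mulr_suml; apply: eq_bigr => p _;
    rewrite mulr_sumr.
apply: cov_le_wt; split.
  apply/allP => r /allpairsP [[p q] /= [/(allP nds) ? /(allP nes) ? ->]] /=.
  exact: mulr_ge0.
move=> x; apply: (le_trans (hds x)); rewrite [leRHS]/comb sumE.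
rewrite [leLHS]/comb !big_seq; apply: ler_sum => p /(allP nds) pge0.
apply: (le_trans (ler_wpM2l pge0 (hes _))).
rewrite /comb mulr_sumr; apply: ler_sum => q _ /=.
by rewrite mulrA mulgA.
Qed.

End Haar.

(** * Compact neighbourhoods and continuous bumps from charts *)

Section Charts.
Context {R : realType} {n : nat} {M : manifoldType R n}.

Lemma chart_map_continuous_at (c : chart R n M) p : chart_dom c p ->
  {for p, continuous (chart_map c)}.
Proof.
move=> cp; have := @chart_map_continuous _ _ _ c.
rewrite continuous_open_subspace; last exact: chart_dom_open.
by move=> /(_ p); apply; rewrite inE.
Qed.

Lemma chart_inv_continuous_at (c : chart R n M) x : chart_cod c x ->
  {for x, continuous (chart_inv c)}.
Proof.
move=> cx; have := @chart_inv_continuous _ _ _ c.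
rewrite continuous_open_subspace; last exact: chart_cod_open.
by move=> /(_ x); apply; rewrite inE.
Qed.

Lemma chart_dom_nbhs (c : chart R n M) p : chart_dom c p -> nbhs p
  (chart_dom c).
Proof. by move=> cp; apply: open_nbhs_nbhs; split=> //;
  exact: chart_dom_open. Qed.

Lemma chart_cod_nbhs (c : chart R n M) x : chart_cod c x -> nbhs x
  (chart_cod c).
Proof. by move=> cp; apply: open_nbhs_nbhs; split=> //;
  exact: chart_cod_open. Qed.

Lemma chart_ball (c : chart R n M) p U : chart_dom c p -> nbhs p U ->
  exists2 e : R, 0 < e & forall x, `|x - chart_map c p| <= e ->
    chart_cod c x /\ U (chart_inv c x).
Proof.
move=> cp pU; have cx := chart_map_cod cp.
have near_x : \forall x \near chart_map c p, chart_cod c x /\ U (chart_inv c x).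
  near=> x; split; near: x; first exact: chart_cod_nbhs.
  by apply: chart_inv_continuous_at => //=; rewrite chart_mapK.
have /nbhs_closedballP [r hr] := near_x.
exists r%:num => // x hx; apply: hr; rewrite closed_ballE //.
by rewrite /closed_ball_ /= distrC.
Unshelve. all: by end_near. Qed.

Lemma chart_ball_compact (c : chart R n M) (x0 : 'rV[R]_n) (e : R) :
  (forall x, `|x - x0| <= e -> chart_cod c x) ->
  compact [set chart_inv c x | x in [set x | `|x - x0| <= e]].
Proof.
move=> he; apply: continuous_compact.
  apply: continuous_in_subspaceT => x; rewrite inE /= => /he.
  exact: chart_inv_continuous_at.
apply: bounded_closed_compact.
  exists (e + `|x0|); split; first exact: num_real.
  move=> b hb x /= hx; rewrite -[x](subrK x0).
  apply: (le_trans (ler_normD _ _)); apply: ltW; apply: le_lt_trans hb.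
  by rewrite lerD2r.
rewrite (_ : [set _ | _] = closed_ball_ Num.norm x0 e).
  exact: closed_closed_ball_.
by apply/seteqP; split=> x /=; rewrite distrC.
Qed.

Lemma manifold_compact_nbhs (p : M) (U : set M) : nbhs p U ->
  exists K, [/\ compact K, K `<=` U & nbhs p K].
Proof.
move=> pU; pose c := chart_at p; have cp : chart_dom c p := chart_at_dom p.
have [e e0 he] := chart_ball cp pU.
exists [set chart_inv c x | x in [set x | `|x - chart_map c p| <= e]]; split.
- by apply: chart_ball_compact => x /he [].
- by move=> _ [x /he [_ ?] <-].
- have near_p : \forall q \near p,
  chart_dom c q /\ `|chart_map c q - chart_map c p| < e.
    near=> q; split; near: q; first exact: chart_dom_nbhs.
    have /cvgrPdist_lt /(_ e e0) := chart_map_continuous_at cp.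
    by apply: filterS => q; rewrite distrC.
  apply: filterS near_p => q [cq hq].
  by exists (chart_map c q); [exact: ltW|exact: chart_mapK].
Unshelve. all: by end_near. Qed.

(** Continuity is all that the covering numbers require, so a tent function of the distance in a
    chart, extended by zero, suffices. *)
Lemma bump_exists (p : M) (U : set M) : nbhs p U ->
  exists f : M -> R, [/\ continuous f, forall q, 0 <= f q, 0 < f p &
    exists K, [/\ compact K, K `<=` U & forall q, ~ K q -> f q = 0]].
Proof.
move=> pU; pose c := chart_at p; have cp : chart_dom c p := chart_at_dom p.
have [e e0 he] := chart_ball cp pU.
pose K := [set chart_inv c x | x in [set x | `|x - chart_map c p| <= e]].
have cK : compact K by apply: chart_ball_compact => x /he [].
pose b q := Num.max (e - `|chart_map c q - chart_map c p|) 0.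
pose f q := if pselect (chart_dom c q) then b q else 0.
have f0 q : ~ K q -> f q = 0.
  rewrite /f; case: pselect => // cq nKq; rewrite /b; apply/max_idPr.
  rewrite subr_le0 leNgt; apply/negP => /ltW h; apply: nKq.
  by exists (chart_map c q) => //; exact: chart_mapK.
exists f; split.
- move=> q; have [cq|ncq] := pselect (chart_dom c q).
    have nearf : {near q, b =1 f}.
      apply: filterS (chart_dom_nbhs cq) => q' cq'.
      by rewrite /f; case: pselect.
    apply: cvg_trans (near_eq_cvg nearf) _.
    rewrite -(nbhs_singleton nearf).
    apply: (@continuous_max R M
      (fun q => e - `|chart_map c q - chart_map c p|) (cst 0)).
      apply: cvgB; first exact: cvg_cst.
      apply: cvg_norm; apply: cvgB; last exact: cvg_cst.
      exact: chart_map_continuous_at.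
    exact: cvg_cst.
  (* Outside the chart domain continuity rests on the Hausdorff property: the compact [K] is closed,
     so [f] vanishes on a neighbourhood of [q]. *)
  have nK : ~ K q.
    by move=> [x /he [cx _] qE]; apply: ncq; rewrite -qE; exact: chart_inv_dom.
  have oK : open (~` K).
    by apply: closed_openC; apply: compact_closed => //;
      exact: manifold_hausdorff.
  have nearf : {near q, cst 0 =1 f}.
    by apply: (filterS _ (open_nbhs_nbhs (conj oK nK))) => q1 /f0 ->.
  apply: cvg_trans (near_eq_cvg nearf) _.
  by rewrite (f0 _ nK); exact: cvg_cst.
- by move=> q; rewrite /f; case: pselect => // ?; rewrite /b le_max lexx orbT.
- rewrite /f; case: pselect => [?|//]; rewrite /b subrr normr0 subr0.
  by rewrite lt_max e0.
- by exists K; split=> // _ [x /he [_ ?] <-].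
Qed.

End Charts.

(** * Approximate superadditivity of covering numbers *)

Section HaarFunctional.
Context {R : realType} {m : nat} {G : lieGroupType R m}.
Implicit Types (f g phi psi h : G -> R) (K V : set G).

Lemma unif_continuous h K e : 0 < e -> continuous h -> compact K ->
  vanishes_off K h ->
  exists2 V, nbhs 1%g V & forall v y, V v -> `|h (v * y)%g - h y| <= e.
Proof.
move=> e0 ch cK hK.
have [V V1 hV] : exists2 V, nbhs 1%g V &
    forall y, K y -> forall v, V v -> `|h (v * y)%g - h y| <= e.
  apply: (compact_set_ind cK (Q := fun A => exists2 V, nbhs 1%g V &
    forall y, A y -> forall v, V v -> `|h (v * y)%g - h y| <= e)).
  - by exists setT => //; exact: filterT.
  - by move=> A B AB [V ? hV]; exists V => // y /AB /hV.
  - move=> A B [V ? hV] [W ? hW]; exists (V `&` W); first exact: filterI.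
    by move=> y [/hV|/hW] H v [? ?]; exact: H.
  - move=> x _.
    have cont : (fun p : G * G => h (p.1 * p.2)%g - h p.2) @ nbhs (1%g, x) -->
      (0 : R).
      have <- : h (1 * x)%g - h x = 0 by rewrite mul1g subrr.
      apply: cvgB.
        apply: (@continuous_comp _ _ _ (fun p : G * G => (p.1 * p.2)%g) h
          (1%g, x)).
          exact: mulg_continuous.
        exact: ch.
      by apply: (@continuous_comp _ _ _ (@snd G G) h (1%g, x));
        [exact: cvg_snd|exact: ch].
    have /cvgrPdist_lt /(_ e e0) [[V U] [/= V1 Ux] hVU] := cont.
    exists U => //; exists V => // y Uy v Vv.
    by have := hVU (v, y) (conj Vv Uy); rewrite /= sub0r normrN => /ltW.
(* Symmetry handles a point [y] outside [K] with [v * y] in [K]: the estimate is then applied at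
   [v * y] with the inverse of [v]. *)
exists (V `&` [set v | V (v^-1)%g]).
  apply: filterI => //.
  have : nbhs (1^-1 : G)%g V by rewrite invg1.
  exact: (@invg_continuous R m G 1%g).
move=> v y [Vv Vv']; have [Ky|nKy] := pselect (K y); first exact: hV.
have [Kvy|nKvy] := pselect (K (v * y)%g).
  by have := hV _ Kvy _ Vv'; rewrite mulKg distrC.
by rewrite (hK _ nKy) (hK _ nKvy) subrr normr0 ltW.
Qed.

(* If [F <= \sum_j c_j phi (x s_j)] with [phi] supported near 1, then
   [f1 = F * (f1 / F)] is dominated by the combination with coefficients
   [c_j * ((f1 / F) s_j^-1 + e / 2)], and likewise for [f2], where
   [f1 / F + f2 / F <= 1]. *)
Lemma cov_superadd f1 f2 F K e : Cc_nneg f1 -> Cc_nneg f2 -> Cc F -> 0 < e ->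
  compact K -> vanishes_off K f1 -> vanishes_off K f2 ->
  (forall x, K x -> 0 < F x) -> (forall x, 0 <= F x) ->
  (forall x, f1 x + f2 x <= F x) ->
  exists2 V, nbhs 1%g V & forall phi, Cc_nneg phi -> 0 < phi 1%g ->
    vanishes_off V phi -> cov phi f1 + cov phi f2 <= (1 + e) * cov phi F.
Proof.
move=> cf1 cf2 cF e0 cK f1K f2K F0 Fge0 fF.
pose h f x := f x / F x.
have hcont f : Cc_nneg f -> vanishes_off K f -> continuous (h f).
  move=> [[cf _] _] fK x.
  have oK : open (~` K).
    by apply: closed_openC; apply: compact_closed => //;
      exact: manifold_hausdorff.
  have [Kx|nKx] := pselect (K x).
    apply: cvgM; first exact: cf.
    by apply: cvgV; [rewrite gt_eqF // F0|case: cF => + _; apply].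
  have nearf : {near x, cst 0 =1 h f}.
    by apply: (filterS _ (open_nbhs_nbhs (conj oK nKx))) => y /fK;
      rewrite /h => ->; rewrite mul0r.
  apply: cvg_trans (near_eq_cvg nearf) _.
  by rewrite /h (fK _ nKx) mul0r; exact: cvg_cst.
have hK f : vanishes_off K f -> vanishes_off K (h f).
  by move=> fK x /fK; rewrite /h => ->; rewrite mul0r.
have e2 : 0 < e / 2 by rewrite divr_gt0.
have [V1 V1n hV1] := unif_continuous e2 (hcont _ cf1 f1K) cK (hK _ f1K).
have [V2 V2n hV2] := unif_continuous e2 (hcont _ cf2 f2K) cK (hK _ f2K).
exists (V1 `&` V2); first exact: filterI.
move=> phi cphi p1 phiV; apply: (le_mul_cov cphi p1) => //.
  by rewrite addr_ge0 // ltW.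
move=> cs [ncs hcs].
pose w f := wt [seq (p.1 * (h f (p.2^-1)%g + e / 2), p.2) | p <- cs].
have hge0 f : Cc_nneg f -> forall x, 0 <= h f x.
  by move=> [_ f0] x; rewrite /h divr_ge0.
have covw f V : Cc_nneg f -> vanishes_off K f -> V1 `&` V2 `<=` V ->
    (forall v y, V v -> `|h f (v * y)%g - h f y| <= e / 2) -> cov phi f <= w f.
  move=> cf fK sV hV; apply: cov_le_wt; split.
    rewrite /nneg_coefs all_map; apply: sub_all ncs => p /= ?.
    by rewrite mulr_ge0 // addr_ge0 ?hge0 // ltW.
  move=> x; have -> : f x = F x * h f x.
    have [Kx|/fK fx0] := pselect (K x); last by rewrite /h fx0 mul0r mulr0.
    by rewrite /h mulrCA divff ?mulr1 // gt_eqF // F0.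
  apply: (le_trans (ler_wpM2r (hge0 _ cf x) (hcs x))).
  rewrite /comb big_map mulr_suml !big_seq;
    apply: ler_sum => p /(allP ncs) pge0 /=.
  rewrite -!mulrA; apply: ler_wpM2l => //; rewrite mulrC.
  (* A term contributes only if [x * p.2] lies near 1. Since [x] is the product of this element and
     the inverse of [p.2], uniform continuity then compares [h f x] with the coefficient. *)
  have [Vx|nVx] := pselect ((V1 `&` V2) (x * p.2)%g); last first.
    by rewrite (phiV _ nVx) !mulr0.
  apply: ler_wpM2r; first by case: cphi.
  have := hV (x * p.2)%g (p.2^-1)%g (sV _ Vx); rewrite mulgK.
  by rewrite ler_distl => /andP[_]; rewrite addrC.
have := lerD (covw f1 V1 cf1 f1K (@subIsetl _ _ _) hV1)
             (covw f2 V2 cf2 f2K (@subIsetr _ _ _) hV2).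
move=> /le_trans; apply.
rewrite /w /wt !big_map -big_split mulr_sumr !big_seq.
apply: ler_sum => p /(allP ncs) pge0 /=.
rewrite -mulrDr mulrC; apply: ler_wpM2r => //.
have : h f1 (p.2^-1)%g + h f2 (p.2^-1)%g <= 1.
  rewrite /h -mulrDl; have [F_eq0|Fn0] := eqVneq (F (p.2^-1)%g) 0.
    by rewrite F_eq0 invr0 mulr0.
  by rewrite ler_pdivrMr ?mul1r // lt_def Fn0 Fge0.
lra.
Qed.

End HaarFunctional.

Lemma le_of_cvg (R : realType) (T : Type) (F : set_system T)
    {FF : ProperFilter F} (f g : T -> R) (a b : R) :
  f @ F --> a -> g @ F --> b -> (\forall x \near F, f x <= g x) -> a <= b.
Proof.
move=> fa gb fg; have gf : (g - f) @ F --> b - a by exact: cvgB.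
rewrite -subr_ge0 -(cvg_lim (@Rhausdorff R) gf); apply: limr_ge.
  by apply/cvg_ex; exists (b - a).
by apply: filterS fg => x; rewrite -subr_ge0.
Qed.

(** * The positive invariant functional as an ultrafilter limit *)

Section HaarExistence.
Context {R : realType} {m : nat} {G : lieGroupType R m}.
Implicit Types (f g phi psi : G -> R) (K V : set G).

Definition small_bump V phi :=
  [/\ Cc_nneg phi, 0 < phi 1%g & vanishes_off V phi].

Lemma small_bump_exists V : nbhs 1%g V -> exists phi, small_bump V phi.
Proof.
move=> V1; have [f [cf f0 f1 [K [cK KV fK]]]] := bump_exists V1.
exists f; split=> //; last by move=> x nVx; apply: fK => /KV.
by split=> //; split=> //; exists K.
Qed.

Lemma Cc_comb phi cs : Cc_nneg phi -> nneg_coefs cs -> Cc_nneg (comb phi cs).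
Proof.
move=> [cphi p0] ncs; split; last by move=> x; exact: comb_ge0.
elim: cs ncs => [_|p cs IH /= /andP[pge0 /IH h]].
  rewrite (_ : comb phi [::] = cst 0); last first.
    by apply/funext => x; rewrite /comb big_nil.
  split; first exact: cst_continuous.
  by exists set0 => //; exact: compact0.
rewrite (_ : comb _ _ = (fun x => p.1 * phi (x * p.2)%g) \+ comb phi cs).
  by apply: Cc_add => //; apply: Cc_scale; exact: Cc_translate.
by apply/funext => x; rewrite /comb big_cons.
Qed.

Lemma Cc_nneg_positive_on K : compact K ->
  exists2 f, Cc_nneg f & forall x, K x -> 0 < f x.
Proof.
move=> cK; have [phi [cphi p1 _]] :=
  small_bump_exists (@filterT _ (nbhs (1%g : G)) _).
have c0 : continuous (cst 0 : G -> R) by exact: cst_continuous.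
have [cs ncs h] := translates_dominate_compact cphi p1 c0 cK.
by exists (comb phi cs) => //; exact: Cc_comb.
Qed.

Lemma image_ultra (T U : Type) (f : T -> U) (F : set_system T) :
  UltraFilter F -> UltraFilter (f @ F).
Proof.
move=> FU; split; first exact: fmap_proper_filter.
move=> H HF sFH; rewrite predeqE => A; split; last exact: sFH.
move=> HA; have [//|FnA] := in_ultra_setVsetC (f @^-1` A) FU.
have HnA : H (~` A) by apply: sFH.
by have /filter_ex [? []] : H (A `&` ~` A) by exact: filterI.
Qed.

(** Convergence along this filter means that the bumps concentrate at 1. One ultrafilter refining it
    serves all functions simultaneously, so no compactness of a product space has to be invoked. *)
Definition bump_filter : set_system (G -> R) :=
  [set P | exists2 V, nbhs (1%g : G) V & forall phi, small_bump V phi -> P phi].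

Lemma bump_filter_proper : ProperFilter bump_filter.
Proof.
apply: Build_ProperFilter_ex.
  by move=> P [V /small_bump_exists [phi hphi] /(_ _ hphi)]; exists phi.
split.
- by exists setT => //; exact: filterT.
- move=> P Q [V V1 hP] [W W1 hQ]; exists (V `&` W); first exact: filterI.
  move=> phi [cphi p1 phiVW]; split.
    by apply: hP; split=> // x nx; apply: phiVW => -[].
  by apply: hQ; split=> // x nx; apply: phiVW => -[].
- by move=> P Q PQ [V V1 hP]; exists V => // phi /hP /PQ.
Qed.

Theorem haar_positive : exists I : (G -> R) -> R,
  [/\ forall f g, Cc_nneg f -> Cc_nneg g -> I (f \+ g) = I f + I g,
      forall c f, Cc_nneg f -> 0 <= c -> I (fun x => c * f x) = c * I f,
      forall h f, Cc_nneg f -> I (fun x => f (x * h)%g) = I f,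
      forall f, Cc_nneg f -> 0 <= I f &
      forall f x, Cc_nneg f -> 0 < f x -> 0 < I f].
Proof.
have [f0 [cf0 f01 _]] := small_bump_exists (@filterT _ (nbhs (1%g : G)) _).
have [U [UU sU]] := ultraFilterLemma bump_filter_proper.
pose r f phi := cov phi f / cov phi f0.
have Ugood : U [set phi | Cc_nneg phi /\ 0 < phi 1%g].
  by apply: sU; exists setT => [|phi []//]; exact: filterT.
have cov0 phi : Cc_nneg phi -> 0 < phi 1%g -> 0 < cov phi f0.
  by move=> cphi p1; apply: (cov_gt0 cphi p1 _ f01); case: cf0.
have rcvg f : Cc_nneg f -> exists l : R, r f @ U --> (l : R).
  (* The inequality [(f : phi) <= (f : f0) (f0 : phi)] keeps the ratio in a compact interval
     independent of [phi], where the image ultrafilter converges. *)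
  move=> cf; have := segment_compact (a := 0) (b := cov f0 f).
  rewrite compact_ultra => /(_ (r f @ U) (image_ultra _ UU)) [].
    apply: (@filterS _ U _ _ _ _ Ugood) => phi [cphi p1]; rewrite /= in_itv /=;
      apply/andP; split.
      by rewrite divr_ge0 ?(cov_ge0 cphi p1)//; [case: cf|case: cf0].
    rewrite ler_pdivrMr ?cov0 //; apply: (cov_comp cphi p1 cf0 f01).
    by case: cf.
  by move=> l [_ ?]; exists l.
pose I f := lim (r f @ U).
have Icvg f : Cc_nneg f -> r f @ U --> I f.
  by move=> /rcvg [l hl]; apply/cvg_ex; exists l.
have Ieq f (l : R) : r f @ U --> (l : R) -> I f = l by move=> /cvg_lim; apply.
have ccpD f g : Cc_nneg f -> Cc_nneg g -> Cc_nneg (f \+ g).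
  by move=> [? ?] [? ?]; split; [exact: Cc_add|move=> x; rewrite addr_ge0].
have ccpZ c f : 0 <= c -> Cc_nneg f -> Cc_nneg (fun x => c * f x).
  by move=> ? [? ?]; split; [exact: Cc_scale|move=> x; rewrite mulr_ge0].
have IZ c f : Cc_nneg f -> 0 <= c -> I (fun x => c * f x) = c * I f.
  move=> cf cge0; apply: Ieq.
  have E : {near U, (fun phi => c * r f phi) =1 r (fun x => c * f x)}.
    apply: (@filterS _ U _ _ _ _ Ugood) => phi [cphi p1];
      rewrite /r (cov_scale cphi p1) //.
      by rewrite mulrA.
    by case: cf.
  apply: cvg_trans (near_eq_cvg E) _.
  by apply: cvgM; [exact: cvg_cst|exact: Icvg].
have Ige0 f : Cc_nneg f -> 0 <= I f.
  move=> cf; rewrite /I; apply: limr_ge.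
    by apply/cvg_ex; exists (I f); exact: Icvg.
  apply: (@filterS _ U _ _ _ _ Ugood) => phi [cphi p1].
  by rewrite divr_ge0 ?(cov_ge0 cphi p1)//; [case: cf|case: cf0].
exists I; split=> //.
- move=> f g cf cg.
  have cfg := ccpD _ _ cf cg.
  have sumcvg : (r f + r g) @ U --> I f + I g by apply: cvgD; exact: Icvg.
  apply/le_anti/andP; split.
    apply: (le_of_cvg (Icvg _ cfg) sumcvg).
    apply: (@filterS _ U _ _ _ _ Ugood) => phi [cphi p1].
    rewrite /= /r -mulrDl ler_pM2r ?invr_gt0 ?cov0 //.
    by apply: (cov_subadd cphi p1); [case: cf|case: cg].
  case: (cf) (cg) => [[_ [K cK fK]] f_ge0] [[_ [L cL gL]] g_ge0].
  have [k ck kpos] := Cc_nneg_positive_on (compactU cK cL).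
  have [[ck' kge0] cfg'] := (ck, cfg.1).
  have fKL : vanishes_off (K `|` L) f by move=> x /not_orP [/fK].
  have gKL : vanishes_off (K `|` L) g by move=> x /not_orP [_ /gL].
  have main e : 0 < e -> I f + I g <= (1 + e) * (I (f \+ g) + e * I k).
    (* Quotients by [f \+ g] need not be continuous where the sum vanishes at the edge of the
       supports. The term [e * k] makes the denominator positive on both supports, at a cost that
       disappears with [e]. *)
    move=> e0; pose F := (f \+ g) \+ (fun x => e * k x).
    have cF : Cc F by apply: Cc_add => //; exact: Cc_scale.
    have [V V1 hV] : exists2 V, nbhs 1%g V & forall phi, Cc_nneg phi ->
      0 < phi 1%g ->
        vanishes_off V phi -> cov phi f + cov phi g <= (1 + e) * cov phi F.
      apply: (cov_superadd cf cg cF e0 (compactU cK cL)) => //.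
      - by move=> x /kpos ?; rewrite ltr_wpDl ?mulr_gt0 //= addr_ge0.
      - by move=> x; rewrite /= !addr_ge0 // mulr_ge0 // ltW.
      - by move=> x; rewrite lerDl mulr_ge0 // ltW.
    have UV : U [set phi | small_bump V phi] by apply: sU; exists V.
    have rhs : (1 + e) * (r (f \+ g) phi + e * r k phi) @[phi --> U] -->
        (1 + e) * (I (f \+ g) + e * I k).
      apply: cvgM; first exact: cvg_cst.
      apply: cvgD; first exact: Icvg.
      by apply: cvgM; [exact: cvg_cst|exact: Icvg].
    apply: (le_of_cvg sumcvg rhs);
      apply: (@filterS _ U _ _ _ _ UV) => phi [cphi p1 phiV].
    have e0' := ltW e0.
    rewrite /= /r [e * (_ / _)]mulrA -!mulrDl [leRHS]mulrA ler_pM2r ?invr_gt0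
      ?cov0 //.
    apply: (le_trans (hV _ cphi p1 phiV)); rewrite ler_pM2l ?addr_gt0 //.
    rewrite -(cov_scale cphi p1) //; apply: (cov_subadd cphi p1) => //.
    exact: Cc_scale.
  apply/ler_addgt0Pr => d d0.
  have b0 := Ige0 _ cfg; have k0 := Ige0 _ ck.
  set b := I (f \+ g) in main b0 *; set kk := I k in main k0.
  (* For [e <= 1] the product [(1 + e) * (b + e * kk)] is at most [b + e * (b + 2 * kk)]; the
     summand 1 makes [D] positive. *)
  pose D := b + 2 * kk + 1; have D0 : 0 < D by rewrite /D; lra.
  pose e := Num.min 1 (d / D).
  have e0 : 0 < e by rewrite lt_min ltr01 divr_gt0.
  have e1 : e <= 1 by rewrite ge_min lexx.
  have eD : e * D <= d by rewrite -ler_pdivlMr // ge_min lexx orbT.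
  apply: (le_trans (main e e0)); apply: le_trans (_ : b + e * D <= _); last
    by rewrite lerD2l.
  have : e * (e * kk) <= e * kk by rewrite ler_piMl // mulr_ge0 // ltW.
  by rewrite /D; lra.
- move=> h f cf; apply: Ieq.
  have E : {near U, r f =1 r (fun x => f (x * h)%g)}.
    apply: (@filterS _ U _ _ _ _ Ugood) => phi [cphi p1];
      rewrite /r (cov_translate cphi p1) //.
    by case: cf.
  by apply: cvg_trans (near_eq_cvg E) _; exact: Icvg.
(* Here [(f0 : phi) <= (f0 : f) (f : phi)] bounds every ratio below by the inverse of [cov f f0], so
   the limit stays positive. *)
- move=> f x cf fx; have f0cov : 0 < cov f f0.
    by apply: (cov_gt0 cf fx _ f01); case: cf0.
  apply: (@lt_le_trans _ _ (cov f f0)^-1); first by rewrite invr_gt0.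
  rewrite /I; apply: limr_ge.
    by apply/cvg_ex; exists (I f); exact: Icvg.
  apply: (@filterS _ U _ _ _ _ Ugood) => phi [cphi p1].
  rewrite /r ler_pdivlMr ?cov0 // ler_pdivrMl //.
  by apply: (cov_comp cphi p1 cf fx); case: cf0.
Qed.

End HaarExistence.

(** * Extension to functions of arbitrary sign *)

Section SignedHaar.
Context {R : realType} {m : nat} {G : lieGroupType R m}.
Implicit Types (f g u v : G -> R) (K V : set G).

Definition pos_part u : G -> R := fun x => Num.max (u x) 0.
Definition neg_part u : G -> R := pos_part (fun x => - u x).

Lemma pos_part_Cc_nneg u : Cc u -> Cc_nneg (pos_part u).
Proof.
move=> [cu [K cK uK]]; split; last by move=> x; rewrite le_max lexx orbT.
split.
  by move=> x; apply: (@continuous_max R G u (cst 0));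
    [exact: cu|exact: cvg_cst].
by exists K => // x /uK; rewrite /pos_part => ->; rewrite maxxx.
Qed.

Lemma Cc_opp u : Cc u -> Cc (fun x => - u x).
Proof.
move=> /(Cc_scale (-1)); congr Cc.
by apply/funext => x; rewrite mulN1r.
Qed.

Lemma neg_part_Cc_nneg u : Cc u -> Cc_nneg (neg_part u).
Proof. by move=> /Cc_opp /pos_part_Cc_nneg. Qed.

Lemma pos_neg_partE u x : u x = pos_part u x - neg_part u x.
Proof.
rewrite /neg_part /pos_part; have [u0|u0] := leP (u x) 0.
  by rewrite (max_idPl _) ?oppr_ge0 // sub0r opprK.
by rewrite (max_idPr _) ?subr0 // oppr_le0 ltW.
Qed.

Theorem haar_functional : exists J : (G -> R) -> R,
  [/\ forall f g, Cc f -> Cc g -> J (f \+ g) = J f + J g,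
      forall c f, Cc f -> J (fun x => c * f x) = c * J f,
      forall h f, Cc f -> J (fun x => f (x * h)%g) = J f,
      forall f x, Cc_nneg f -> 0 < f x -> 0 < J f &
      forall K, compact K -> exists2 C, 0 <= C & forall u B, Cc u ->
        vanishes_off K u -> (forall x, `|u x| <= B) -> `|J u| <= C * B].
Proof.
have [I [ID IZ It I0 Ipos]] := @haar_positive R m G.
pose J u := I (pos_part u) - I (neg_part u).
have ccpD f g : Cc_nneg f -> Cc_nneg g -> Cc_nneg (f \+ g).
  by move=> [? ?] [? ?]; split; [exact: Cc_add|move=> x; rewrite addr_ge0].
have ccpZ c f : 0 <= c -> Cc_nneg f -> Cc_nneg (fun x => c * f x).
  by move=> ? [? ?]; split; [exact: Cc_scale|move=> x; rewrite mulr_ge0].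
(* Any decomposition of [u] computes [J u]: the equality of [pos_part u + q] and [neg_part u + p]
   involves nonnegative functions only, so [I] is additive on both sides. Linearity of [J] follows
   by choosing convenient decompositions. *)
have Jdiff u p q : Cc u -> Cc_nneg p -> Cc_nneg q ->
  (forall x, u x = p x - q x) ->
    J u = I p - I q.
  move=> cu cp cq upq; rewrite /J; apply/eqP;
    rewrite subr_eq addrAC eq_sym subr_eq.
  have cpu := pos_part_Cc_nneg cu; have cnu := neg_part_Cc_nneg cu.
  rewrite -!ID //; apply/eqP; congr I; apply/funext => x /=.
  by have := upq x; rewrite (pos_neg_partE u); lra.
have JI f : Cc_nneg f -> J f = I f.
  move=> cf; have c0 : Cc_nneg (fun x => 0 * f x) by exact: ccpZ.
  rewrite (Jdiff f f (fun x => 0 * f x)) ?IZ ?mul0r ?subr0 //; first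
    by case: cf.
  by move=> x; rewrite mul0r subr0.
exists J; split.
- move=> f g cf cg.
  have [p1 p2] := (pos_part_Cc_nneg cf, pos_part_Cc_nneg cg).
  have [n1 n2] := (neg_part_Cc_nneg cf, neg_part_Cc_nneg cg).
  rewrite (Jdiff _ (pos_part f \+ pos_part g) (neg_part f \+ neg_part g)) //.
  + by rewrite !ID // /J; ring.
  + exact: Cc_add.
  + exact: ccpD.
  + exact: ccpD.
  + by move=> x; rewrite /= (pos_neg_partE f) (pos_neg_partE g); ring.
- move=> c f cf; have [cp cn] := (pos_part_Cc_nneg cf, neg_part_Cc_nneg cf).
  have [c0|/ltW c0] := leP 0 c.
    rewrite (Jdiff _ (fun x => c * pos_part f x) (fun x => c * neg_part f x)).
    + by rewrite !IZ // /J mulrBr.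
    + exact: Cc_scale.
    + exact: ccpZ.
    + exact: ccpZ.
    + by move=> x; rewrite (pos_neg_partE f); ring.
  have c0' : 0 <= - c by rewrite oppr_ge0.
  rewrite (Jdiff _ (fun x => - c * neg_part f x) (fun x => - c * pos_part f x)).
  + by rewrite !IZ // /J; ring.
  + exact: Cc_scale.
  + exact: ccpZ.
  + exact: ccpZ.
  + by move=> x; rewrite (pos_neg_partE f); ring.
- move=> h f cf.
  transitivity (I (fun x => pos_part f (x * h)%g) - I
    (fun x => neg_part f (x * h)%g)).
    by [].
  rewrite (It h (pos_part f)); last exact: pos_part_Cc_nneg.
  by rewrite (It h (neg_part f)) //; exact: neg_part_Cc_nneg.
- by move=> f x cf fx; rewrite JI //; exact: Ipos cf fx.
- move=> K cK; have [phi [cphi p1 _]] :=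
  small_bump_exists (@filterT _ (nbhs (1%g : G)) _).
  have [cs ncs hcs] := translates_dominate_compact cphi p1
    (@cst_continuous G R 1) cK.
  (* Since [k] exceeds 1 on [K], the function [B * k] dominates both the positive and the negative
     part of [u]. *)
  pose k := comb phi cs; have ck : Cc_nneg k by exact: Cc_comb.
  exists (2 * I k); first by rewrite mulr_ge0 // I0.
  move=> u B cu uK uB.
  have B0 : 0 <= B := le_trans (normr_ge0 _) (uB 1%g).
  have bound w : Cc_nneg w -> (forall x, w x <= B * k x) -> I w <= B * I k.
    move=> cw wk; rewrite -IZ // -subr_ge0.
    have cd : Cc_nneg (fun x => B * k x - w x).
      split; last by move=> x; rewrite subr_ge0.
      have := Cc_add (Cc_scale B ck.1) (Cc_scale (-1) cw.1).
      by congr Cc; apply/funext => x; rewrite /= mulN1r.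
    rewrite (_ : (fun x => B * k x) = (fun x => B * k x - w x) \+ w).
      by rewrite ID // addrK I0.
    by apply/funext => x /=; rewrite subrK.
  have ub (s : bool) x : Num.max ((-1) ^+ s * u x) 0 <= B * k x.
    have [Kx|/uK ux] := pselect (K x); last first.
      by rewrite ux mulr0 maxxx mulr_ge0 //; case: ck.
    rewrite ge_max mulr_ge0 ?andbT //; last by case: ck.
    apply: (@le_trans _ _ B); last by rewrite ler_peMr // ltW //; exact: hcs.
    apply: le_trans (uB x); rewrite -(normrMsign s).
    exact: ler_norm.
  have b1 : I (pos_part u) <= B * I k.
    apply: bound; first exact: pos_part_Cc_nneg.
    by move=> x; have := ub false x; rewrite expr0 mul1r.
  have b2 : I (neg_part u) <= B * I k.
    apply: bound; first exact: neg_part_Cc_nneg.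
    by move=> x; have := ub true x; rewrite expr1 mulN1r.
  have [i1 i2] := (I0 _ (pos_part_Cc_nneg cu), I0 _ (neg_part_Cc_nneg cu)).
  by rewrite /J ler_norml; apply/andP; split; lra.
Qed.

End SignedHaar.

(** * Smooth functions on normed spaces *)

Section Calculus.
Context {R : realType}.

(** The bound by [k] supplies the continuity that a differential must have on a general normed
    space. A candidate derivative can then be confirmed by a first-order estimate alone. *)
Lemma differentiable_of_linear_approx (V W : normedModType R)
  (f L : V -> W) x k :
  linear L -> (forall h, `|L h| <= k * `|h|) ->
  (forall e : R, 0 < e -> \forall h \near (0 : V),
    `|f (x + h) - f x - L h| <= e * `|h|) ->
  differentiable f x /\ forall v, 'D_v f x = L v.
Proof.
move=> lin_L Lk approx.
pose linM := GRing.isLinear.Build _ _ _ _ L lin_L.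
pose Lf : {linear V -> W} := HB.pack L linM.
have cL : continuous Lf.
  apply/linear_bounded_continuous; rewrite /bounded_near.
  near=> B; apply/nbhs_ballP; exists 1 => //= h.
  rewrite -ball_normE /= sub0r normrN => h1; apply: (le_trans (Lk h)).
  apply: (@le_trans _ _ `|k|); last by near: B; exact: nbhs_pinfty_ge.
  apply: (le_trans (ler_wpM2r (normr_ge0 h) (ler_norm k))).
  by rewrite ler_piMr // ltW.
have fL : f \o shift x = cst (f x) + Lf +o_ (0 : V) id.
  apply/eqaddoP => e e0; apply: filterS (approx e e0) => h /=.
  by rewrite [x + h]addrC /cst opprD addrA.
have dE := diff_unique cL fL.
have df : differentiable f x by apply/diff_locallyP; rewrite dE.
by split=> // v; rewrite deriveE // dE.
Unshelve. all: by end_near. Qed.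

Let line_quotientE (V W : normedModType R) (f : V -> W) x h (t : R) :
  (fun s : R => s^-1 *: (((fun s : R => f (x + s *: h)) \o shift t)
    (s *: (1 : R))
                          - f (x + t *: h))) =
  (fun s => s^-1 *: ((f \o shift (x + t *: h)) (s *: h) - f (x + t *: h))).
Proof.
apply/funext => s /=; do 3 congr (_ _).
by rewrite [s *: 1]mulr1 scalerDl addrCA.
Qed.

Lemma derive_lineE (V W : normedModType R) (f : V -> W) x h (t : R) :
  derive (fun s : R => f (x + s *: h)) t 1 = 'D_h f (x + t *: h).
Proof. by rewrite /derive line_quotientE. Qed.

Lemma derivable_line (V W : normedModType R) (f : V -> W) x h (t : R) :
  derivable f (x + t *: h) h -> derivable (fun s : R => f (x + s *: h)) t 1.
Proof. by rewrite /derivable line_quotientE. Qed.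

Lemma line_MVT (V : normedModType R) (f : V -> R) x h :
  (forall t : R, 0 <= t <= 1 -> differentiable f (x + t *: h)) ->
  exists2 t : R, 0 <= t <= 1 & f (x + h) - f x = 'D_h f (x + t *: h).
Proof.
move=> df; pose phi (s : R) := f (x + s *: h).
have dphi (t : R) : 0 <= t <= 1 -> is_derive t 1 phi ('D_h f (x + t *: h)).
  move=> /df dft; split; last exact: derive_lineE.
  by apply: derivable_line; exact: diff_derivable.
have [|||t] := @MVT_segment R phi (fun t => 'D_h f (x + t *: h)) 0 1.
- exact: ler01.
- by move=> t; rewrite in_itv /= => /andP[/ltW t0 /ltW t1]; apply: dphi;
  rewrite t0.
- apply: continuous_in_subspaceT => t; rewrite inE /= in_itv /= => /dphi dt.
  by apply: differentiable_continuous; apply/derivable1_diffP; case: dt.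
rewrite in_itv /= => t01; rewrite /phi scale1r scale0r addr0 subr0 mulr1 => fE.
by exists t.
Qed.

Lemma derive_chain (U V W : normedModType R) (f : U -> V) (g : V -> W) x v :
  differentiable f x -> differentiable g (f x) ->
  'D_v (g \o f) x = 'D_('D_v f x) g (f x).
Proof.
move=> df dg; rewrite deriveE; last exact: differentiable_comp.
by rewrite diff_comp //= -deriveE // -deriveE.
Qed.

Lemma derive_row_sum (W : normedModType R) n (f : 'rV[R]_n -> W) x h :
  differentiable f x -> 'D_h f x = \sum_i h 0 i *: 'D_(delta_mx 0 i) f x.
Proof.
move=> df; rewrite deriveE // [h in LHS]row_sum_delta linear_sum.
by apply: eq_bigr => i _; rewrite linearZ /= deriveE.
Qed.

Lemma derive_linear_in (V W : normedModType R) (f : V -> W) x :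
  differentiable f x -> linear (fun v => 'D_v f x).
Proof. by move=> df a u v; rewrite !deriveE // linearP. Qed.

End Calculus.

Section NearDifferentiable.
Context {R : realType} {V W : normedModType R}.
Implicit Types f g : V -> W.

Lemma diff_approx f x : differentiable f x -> forall e : R, 0 < e ->
  \forall h \near (0 : V), `|f (x + h) - f x - 'd f x h| <= e * `|h|.
Proof.
move=> /diff_locally /eqaddoP fx e e0; apply: filterS (fx e e0) => h /=.
by rewrite [x + h]addrC /cst !fctE opprD addrA.
Qed.

Lemma near_eq_differentiable f g x : (\forall y \near x, f y = g y) ->
  differentiable f x -> differentiable g x.
Proof.
move=> fg df; have [k _ hk] := linear_lipschitz (diff_continuous df).
apply: (differentiable_of_linear_approx (L := 'd f x) (k := k) _ hk _).1.
  by move=> a u v; rewrite linearP.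
move=> e e0; rewrite -(nbhs_singleton fg).
have fg' : \forall h \near (0 : V), f (x + h) = g (x + h).
  move: fg; rewrite (near_shift 0); apply: filterS => h /=.
  by rewrite subr0 addrC.
by apply: filterS2 fg' (diff_approx df e0) => h ->.
Qed.

End NearDifferentiable.

(** * Closure properties of C^k functions *)

Section CkTheory.
Context {R : realType}.
Implicit Types (U V W : normedModType R).

(** Rules of differentiation give equalities at the points of [A] only, whereas [Ck] speaks of
    functions on the whole space. As [A] is open, derivatives at its points ignore the values
    outside. *)
Lemma Ck_ext V W k (A : set V) (f g : V -> W) : open A ->
  (forall x, A x -> f x = g x) -> Ck k A f -> Ck k A g.
Proof.
move=> oA; elim: k f g => [|k IH] f g fg /=.
  move=> cf x Ax; rewrite /prop_for /continuous_at -(fg _ Ax).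
  apply: cvg_trans (cf x Ax); apply: near_eq_cvg.
  by apply: filterS (open_nbhs_nbhs (conj oA Ax)) => y /fg.
have near_fg x : A x -> \forall y \near x, f y = g y.
  by move=> Ax; apply: filterS (open_nbhs_nbhs (conj oA Ax)) => y /fg.
move=> [df Df]; split=> [x Ax|v]; last first.
  by apply: IH (Df v) => x /near_fg ?; exact: near_eq_derive.
by apply: near_eq_differentiable (df _ Ax); exact: near_fg.
Qed.

Lemma Ck_continuous V W k (A : set V) (f : V -> W) : Ck k A f ->
  forall x, A x -> {for x, continuous f}.
Proof.
case: k => [//|k [df _] x /df]; exact: differentiable_continuous.
Qed.

Lemma Ck_pred V W k (A : set V) (f : V -> W) : Ck k.+1 A f -> Ck k A f.
Proof.
elim: k f => [|k IH] f.
  by move=> cf x; exact: (Ck_continuous cf).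
by move=> [df Df]; split=> // v; exact: IH.
Qed.

Lemma Ck_cst V W k (A : set V) (c : W) : Ck k A (cst c).
Proof.
elim: k c => [|k IH] c /=; first by move=> x _; exact: cst_continuous.
split=> [x _|v]; first exact: differentiable_cst.
rewrite (_ : (fun x => _) = cst 0) //; apply/funext => x.
exact: derive_cst.
Qed.

Lemma Ck_add V W k (A : set V) (f g : V -> W) : open A ->
  Ck k A f -> Ck k A g -> Ck k A (fun x => f x + g x).
Proof.
move=> oA; elim: k f g => [|k IH] f g.
  by move=> cf cg x Ax; apply: cvgD; [exact: cf|exact: cg].
move=> [df Df] [dg Dg]; split=> [x Ax|v].
  by apply: differentiableD; [exact: df|exact: dg].
apply: (Ck_ext oA _ (IH _ _ (Df v) (Dg v))) => x Ax.
by rewrite -deriveD //; apply: diff_derivable; [exact: df|exact: dg].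
Qed.

Lemma Ck_mul V k (A : set V) (f g : V -> R) : open A ->
  Ck k A f -> Ck k A g -> Ck k A (fun x => f x * g x).
Proof.
move=> oA; elim: k f g => [|k IH] f g.
  by move=> cf cg x Ax; apply: cvgM; [exact: cf|exact: cg].
move=> Cf Cg; move: (Cf) (Cg) => [df Df] [dg Dg]; split=> [x Ax|v].
  by apply: differentiableM; [exact: df|exact: dg].
have CfDg := IH _ _ (Ck_pred Cf) (Dg v).
have CgDf := IH _ _ (Ck_pred Cg) (Df v).
apply: (Ck_ext oA _ (Ck_add oA CfDg CgDf)) => x Ax.
have := @deriveM R V f g x v (diff_derivable (df _ Ax))
  (diff_derivable (dg _ Ax)).
by move=> ->.
Qed.

Lemma Ck_sum V k (A : set V) (I : Type) (s : seq I) (f : I -> V -> R) :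
  open A ->
  (forall i, Ck k A (f i)) -> Ck k A (fun x => \sum_(i <- s) f i x).
Proof.
move=> oA Cf; elim: s => [|i s IH].
  by apply: (Ck_ext oA _ (Ck_cst k A 0)) => x _; rewrite big_nil.
by apply: (Ck_ext oA _ (Ck_add oA (Cf i) IH)) => x _; rewrite big_cons.
Qed.

Lemma derive_linear V W (L : {linear V -> W}) x v : continuous L ->
  'D_v L x = L v.
Proof. by move=> cL; rewrite deriveE ?diff_lin //;
  exact: linear_differentiable. Qed.

Lemma Ck_linear_comp U V W k (A : set U) (f : U -> V) (L : {linear V -> W}) :
  open A -> continuous L -> Ck k A f -> Ck k A (fun x => L (f x)).
Proof.
move=> oA cL; elim: k f => [|k IH] f.
  move=> cf x Ax; apply: (@continuous_comp _ _ _ f L); first exact: cf.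
  exact: cL.
move=> [df Df]; split=> [x Ax|v].
  by apply: (@differentiable_comp _ _ _ _ f L);
    [exact: df|exact: linear_differentiable].
apply: (Ck_ext oA _ (IH _ (Df v))) => x Ax.
rewrite (derive_chain (f := f) (g := L));
  [|exact: df|exact: linear_differentiable].
by rewrite derive_linear.
Qed.

Lemma Ck_linear V W k (L : {linear V -> W}) : continuous L -> Ck k setT L.
Proof.
move=> cL; case: k => [|k] /=; first by move=> x _; exact: cL.
split=> [x _|v]; first exact: linear_differentiable.
rewrite (_ : (fun x => _) = cst (L v)); first exact: Ck_cst.
by apply/funext => x; rewrite derive_linear.
Qed.

Lemma derive_comp1 V (r : R -> R) (q : V -> R) x v d : differentiable q x ->
  is_derive (q x) 1 r d -> 'D_v (r \o q) x = d * 'D_v q x.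
Proof.
move=> dq [dr <-]; have dr' : differentiable r (q x) by apply/derivable1_diffP.
rewrite derive_chain // deriveE // -[X in 'd r _ X]mulr1.
by rewrite -[_ * 1]/(_ *: (1 : R)) linearZ /= -deriveE // mulrC.
Qed.

(* [r] is smooth as soon as it belongs to a family of functions closed under
   differentiation. *)
Lemma Ck_comp1 V k (A : set V) (q : V -> R) (D : set (R -> R)) : open A ->
  (forall r, D r -> exists2 r', D r' & forall t : R, is_derive t 1 r (r' t)) ->
  Ck k A q -> forall r, D r -> Ck k A (r \o q).
Proof.
move=> oA Dder; elim: k => [|k IH] Cq r Dr.
  have [r' _ rr'] := Dder _ Dr.
  move=> x Ax; apply: continuous_comp; first exact: Cq.
  by apply: differentiable_continuous; apply/derivable1_diffP;
    case: (rr' (q x)).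
have [r' Dr' rr'] := Dder _ Dr; case: (Cq) => dq Dq; split=> [x Ax|v].
  apply: differentiable_comp; first exact: dq.
  by apply/derivable1_diffP; case: (rr' (q x)).
apply: (Ck_ext oA _ (Ck_mul oA (IH (Ck_pred Cq) _ Dr') (Dq v))) => x Ax.
by rewrite (derive_comp1 _ (dq _ Ax) (rr' _)).
Qed.

End CkTheory.

(** * A smooth function vanishing on the negative half-line *)

Section FlatFunction.
Context {R : realType}.
Implicit Types p : {poly R}.

(* The functions [p(1/t) exp(-1/t)] are closed under differentiation. *)
Definition flat p (t : R) : R := if 0 < t then p.[t^-1] * expR (- t^-1) else 0.

(** Termwise, [s ^ k <= k! exp(s)] for [s >= 0], because the left side divided by [k!] is one term
    of the exponential series. *)
Lemma poly_le_expR p : exists2 C, 0 <= C & forall s : R, 0 <= s ->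
  `|p.[s]| <= C * expR s.
Proof.
have pow_le k (s : R) : 0 <= s -> s ^+ k <= k`!%:R * expR s.
  move=> s0; case: k => [|k].
    by rewrite expr0 mul1r; apply: le_trans (expR_ge1Dx _); rewrite lerDl.
  rewrite mulrC -ler_pdivrMr ?ltr0n ?fact_gt0 //.
  by apply: le_trans (expR_ge1Dxn k s0); rewrite lerDr.
exists (\sum_(i < size p) `|p`_i| * i`!%:R).
  by apply: sumr_ge0 => i _; rewrite mulr_ge0.
move=> s s0; rewrite horner_coef mulr_suml;
  apply: (le_trans (ler_norm_sum _ _ _)).
apply: ler_sum => i _; rewrite normrM -mulrA; apply: ler_wpM2l => //.
by rewrite ger0_norm ?exprn_ge0 // pow_le.
Qed.

(* Both the continuity and the differentiability of [flat p] at 0. *)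
Lemma flat_quadratic p : exists2 C, 0 <= C
  & forall t, `|flat p t| <= C * t ^+ 2.
Proof.
(* At [s = 1/t] the extra factor ['X^2] is [t ^- 2]; moved to the other side it becomes the
   quadratic bound. *)
have [C C0 hC] := poly_le_expR ('X^2 * p).
exists C => // t; rewrite /flat; case: ltP => t0; last first.
  by rewrite normr0 mulr_ge0 // exprn_even_ge0.
have s0 : 0 <= t^-1 by rewrite invr_ge0 ltW.
have := hC _ s0; rewrite hornerM hornerXn (normrM (_ ^+ 2)) (normrM p.[_]).
rewrite (ger0_norm (expR_ge0 _)) (ger0_norm (exprn_ge0 2 s0)) => h.
rewrite expRN ler_pdivrMr ?expR_gt0 // -mulrA mulrCA.
rewrite -ler_pdivrMl ?exprn_gt0 //; move: h.
by rewrite exprVn.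
Qed.

Lemma flat_derive p : exists q, forall t : R, is_derive t 1 (flat p) (flat q t).
Proof.
(* With [s = 1/t] one has [ds/dt = - s^2], and the derivative of [p(s) exp(-s)] in [s] is
   [(p'(s) - p(s)) exp(-s)]. *)
exists ('X^2 * (p - p^`())) => t.
have [t0|t0|<-] := ltgtP 0 t.
- have H : is_derive t 1 (fun t => p.[t^-1] * expR (- t^-1))
      (flat ('X^2 * (p - p^`())) t).
    have dinv : is_derive t 1 (fun t : R => t^-1) (- t ^- 2).
      have := @is_deriveV R id t 1 1 (lt0r_neq0 t0) (is_derive_id _ _).
      by rewrite [_ *: 1]mulr1.
    have dp : is_derive (t^-1) 1 (horner p) (p^`()).[t^-1].
      by split; [exact: derivable_horner|rewrite derivE derive1E].
    have d1 := is_derive1_comp dp dinv.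
    have dinvN : is_derive t 1 (fun t : R => - t^-1) (t ^- 2).
      by rewrite -[t ^- 2]opprK; exact: is_deriveN.
    have d2 := @is_derive1_comp R expR (fun t : R => - t^-1) t _ _
      (is_derive_expR _) dinvN.
    have := is_deriveM d1 d2; rewrite /flat t0 => H.
    apply: (is_derive_eq H); rewrite /= hornerM hornerXn hornerD hornerN.
    rewrite -[_ *: _]/(_ * _) -[X in _ + X = _]/(_ * _) -!exprVn.
    ring.
  apply: near_eq_is_derive H.
  near=> s; rewrite /flat ifT //; near: s; exact: lt_nbhsr.
- rewrite /flat ltNge ltW //=.
  apply: near_eq_is_derive (is_derive_cst 0 t 1).
  near=> s; rewrite /cst /flat ifF //; apply/negbTE; rewrite -leNgt ltW //.
  by near: s; exact: lt_nbhsl.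
- have -> : flat ('X^2 * (p - p^`())) 0 = 0 by rewrite /flat ltxx.
  have [C C0 hC] := flat_quadratic p.
  have f0 : flat p 0 = 0 by rewrite /flat ltxx.
  have [] := @differentiable_of_linear_approx R R R (flat p) (fun=> 0) 0 0.
  + by move=> a u v; rewrite scaler0 addr0.
  + by move=> h; rewrite normr0 mul0r.
  + move=> e e0; near=> h; rewrite add0r f0 !subr0.
    apply: (le_trans (hC h)); rewrite -real_normK ?num_real // expr2 mulrA.
    apply: ler_wpM2r => //.
    have hs : `|h| <= e / (C + 1).
      near: h; apply/nbhs_ballP; exists (e / (C + 1)) => /=.
        by rewrite divr_gt0 // ltr_wpDl.
      by move=> h; rewrite -ball_normE /= sub0r normrN => /ltW.
    apply: (le_trans (ler_wpM2l C0 hs)); rewrite mulrCA ler_piMr ?(ltW e0) //.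
    by rewrite ler_pdivrMr ?mul1r ?lerDl // ltr_wpDl.
  by move=> d D; split; [apply/derivable1_diffP|exact: D].
Unshelve. all: by end_near. Qed.

Lemma Ck_flat (V : normedModType R) k (A : set V) (q : V -> R) p : open A ->
  Ck k A q -> Ck k A (flat p \o q).
Proof.
move=> oA Cq; apply: (Ck_comp1 (D := range flat) oA _ Cq); last by exists p.
by move=> _ [r _ <-]; have [s hs] := flat_derive r; exists (flat s) => //;
  exists s.
Qed.

Lemma flat1_gt0 t : 0 < t -> 0 < flat 1 t.
Proof. by move=> t0; rewrite /flat t0 hornerC mul1r expR_gt0. Qed.

Lemma flat1_ge0 t : 0 <= flat 1 t.
Proof. by have [/flat1_gt0/ltW//|] := ltP 0 t; rewrite /flat ltNge => ->. Qed.

Lemma flat_le0 p t : t <= 0 -> flat p t = 0.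
Proof. by rewrite /flat ltNge => ->. Qed.

End FlatFunction.

(** * Linear maps on matrix spaces *)

Section MatrixLinear.
Context {R : realType}.

Lemma mx_entry_le_norm p q (x : 'M[R]_(p, q)) i j : `|x i j| <= `|x|.
Proof.
rewrite [leRHS]/Num.Def.normr /= mx_normrE.
by apply: le_trans (le_bigmax _ _ (i, j)).
Qed.

Lemma mx_linear_lipschitz p q (W : normedModType R)
  (L : {linear 'M[R]_(p, q) -> W}) x :
  `|L x| <= (\sum_i \sum_j `|L (delta_mx i j)|) * `|x|.
Proof.
rewrite [x in L x]matrix_sum_delta linear_sum mulr_suml.
apply: (le_trans (ler_norm_sum _ _ _)); apply: ler_sum => i _.
rewrite linear_sum mulr_suml; apply: (le_trans (ler_norm_sum _ _ _)).
apply: ler_sum => j _; rewrite linearZ normrZ mulrC; apply: ler_wpM2l => //.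
exact: mx_entry_le_norm.
Qed.

Lemma mx_linear_continuous p q (W : normedModType R) (f : 'M[R]_(p, q) -> W) :
  linear f -> continuous f.
Proof.
move=> lin_f; pose L : {linear 'M[R]_(p, q) -> W} :=
  HB.pack f (GRing.isLinear.Build _ _ _ _ f lin_f).
suff : continuous L by [].
apply/linear_bounded_continuous; rewrite /bounded_near.
pose k := \sum_i \sum_j `|L (delta_mx i j)|.
have k0 : 0 <= k by apply: sumr_ge0 => i _; apply: sumr_ge0.
near=> B; apply/nbhs_ballP; exists 1 => //= h.
rewrite -ball_normE /= sub0r normrN => h1;
  apply: (le_trans (mx_linear_lipschitz L h)).
apply: (@le_trans _ _ k); last by near: B; apply: nbhs_pinfty_ge;
  exact: num_real.
by rewrite ler_piMr // ltW.
Unshelve. all: by end_near. Qed.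

Lemma mx_linear_differentiable p q (W : normedModType R)
  (f : 'M[R]_(p, q) -> W) x :
  linear f -> differentiable f x.
Proof.
move=> lin_f; pose L : {linear 'M[R]_(p, q) -> W} :=
  HB.pack f (GRing.isLinear.Build _ _ _ _ f lin_f).
suff : differentiable L x by [].
by apply: linear_differentiable; exact: mx_linear_continuous.
Qed.

Lemma mx_derive_linear p q (W : normedModType R) (f : 'M[R]_(p, q) -> W) x v :
  linear f -> 'D_v f x = f v.
Proof.
move=> lin_f; pose L : {linear 'M[R]_(p, q) -> W} :=
  HB.pack f (GRing.isLinear.Build _ _ _ _ f lin_f).
suff : 'D_v L x = L v by [].
by apply: derive_linear; exact: mx_linear_continuous.
Qed.

End MatrixLinear.

Lemma pairl_continuous (T U : topologicalType) (t : T) : continuous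
  (fun u : U => (t, u)).
Proof. by move=> u; apply: cvg_pair => /=; [exact: cvg_cst|exact: cvg_id]. Qed.

Lemma pairr_continuous (T U : topologicalType) (u : U) : continuous
  (fun t : T => (t, u)).
Proof. by move=> t; apply: cvg_pair => /=; [exact: cvg_id|exact: cvg_cst]. Qed.

(** * C^k functions depending on a topological parameter *)

Section ParametrizedCk.
Context {R : realType} {T : topologicalType} {n : nat}.
Implicit Types (F : T -> 'rV[R]_n -> R) (A : set (T * 'rV[R]_n)).

(* [C^k] in the second variable, all the derivatives being continuous in both
   variables jointly. *)
Fixpoint Ckpar (k : nat) A F : Prop :=
  (forall p, A p -> {for p, continuous (fun q => F q.1 q.2)}) /\
  match k with
  | 0%N => True
  | j.+1 => (forall p, A p -> differentiable (F p.1) p.2) /\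
            (forall v, Ckpar j A (fun t x => 'D_v (F t) x))
  end.

Lemma Ckpar_continuous k A F : Ckpar k A F ->
  forall p, A p -> {for p, continuous (fun q => F q.1 q.2)}.
Proof. by case: k => [|k] [cF _]; exact: cF. Qed.

Lemma Ckpar_ext k A F F' : open A ->
  (forall p, A p -> F p.1 p.2 = F' p.1 p.2) ->
  Ckpar k A F -> Ckpar k A F'.
Proof.
move=> oA; have nearA p : A p -> \forall q \near p, A q.
  by move=> Ap; exact: (open_nbhs_nbhs (conj oA Ap)).
have near2 t x : A (t, x) -> \forall y \near x, A (t, y).
  by move=> At; exact: (@pairl_continuous _ _ t x _ (nearA _ At)).
elim: k F F' => [|k IH] F F' FF' /= [cF dF]; split.
- move=> p Ap; rewrite /prop_for /continuous_at -(FF' _ Ap).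
  by apply: cvg_trans (cF p Ap); apply: near_eq_cvg;
    apply: filterS (nearA _ Ap) => y /FF'.
- by [].
- move=> p Ap; rewrite /prop_for /continuous_at -(FF' _ Ap).
  by apply: cvg_trans (cF p Ap); apply: near_eq_cvg;
    apply: filterS (nearA _ Ap) => y /FF'.
- have nearF t x : A (t, x) -> \forall y \near x, F t y = F' t y.
    by move=> /near2; apply: filterS => y /FF'.
  case: dF => dF DF; split.
    by move=> [t x] Ap; apply: near_eq_differentiable (dF _ Ap); exact: nearF.
  move=> v; apply: IH (DF v) => -[t x] Ap /=; apply: near_eq_derive.
  exact: nearF.
Qed.

(** Every clause is a condition at a single point, so the set on which it is checked may depend on
    the point. This allows [F] to be described by different formulas in different regions. *)
Lemma Ckpar_local k A F :
  (forall p, A p -> exists B, [/\ B p & Ckpar k B F]) -> Ckpar k A F.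
Proof.
elim: k F => [|k IH] F h /=; split=> //.
- by move=> p /h [B [Bp [cF _]]]; exact: cF.
- by move=> p /h [B [Bp [cF _]]]; exact: cF.
- split; first by move=> p /h [B [Bp [_ [dF _]]]]; exact: dF.
  by move=> v; apply: IH => p /h [B [Bp [_ [_ DF]]]]; exists B; split=> //;
    exact: DF.
Qed.

Lemma Ckpar0 k A : Ckpar k A (fun _ _ => 0).
Proof.
elim: k => [|k IH] /=; split=> //; try by move=> p _; exact: cst_continuous.
split=> [p _|v]; first exact: differentiable_cst.
move: IH; congr (Ckpar k A _).
by apply/funext => t; apply/funext => x; rewrite derive_cst.
Qed.

Lemma row_mx_affine (m : nat) (y : 'rV[R]_m) (x : 'rV[R]_n) :
  row_mx y x = row_mx y 0 + row_mx 0 x.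
Proof. by rewrite add_row_mx addr0 add0r. Qed.

Lemma row_mx_linear_r (m : nat) : linear
  (fun x : 'rV[R]_n => row_mx (0 : 'rV[R]_m) x).
Proof. by move=> a u v; rewrite scale_row_mx add_row_mx scaler0 addr0. Qed.

Lemma row_mx_linear_l (m : nat) : linear
  (fun y : 'rV[R]_m => row_mx y (0 : 'rV[R]_n)).
Proof. by move=> a u v; rewrite scale_row_mx add_row_mx scaler0 addr0. Qed.

Lemma row_mx_differentiable_r (m : nat) (y : 'rV[R]_m) (x : 'rV[R]_n) :
  differentiable (fun x => row_mx y x) x.
Proof.
rewrite (_ : (fun x => _) = cst (row_mx y 0) +
  (fun x => row_mx (0 : 'rV[R]_m) x)); last first.
  by apply/funext => z; rewrite row_mx_affine.
apply: differentiableD; first exact: differentiable_cst.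
by apply: mx_linear_differentiable; exact: row_mx_linear_r.
Qed.

Lemma row_mx_differentiable_l (m : nat) (y : 'rV[R]_m) (x : 'rV[R]_n) :
  differentiable (fun y => row_mx y x) y.
Proof.
rewrite (_ : (fun y => _) = (fun y => row_mx y (0 : 'rV[R]_n)) + cst
  (row_mx 0 x)); last first.
  by apply/funext => z; rewrite row_mx_affine.
apply: differentiableD; last exact: differentiable_cst.
by apply: mx_linear_differentiable; exact: row_mx_linear_l.
Qed.

Lemma derive_row_mx_r (m : nat) (W : normedModType R)
  (Psi : 'rV[R]_(m + n) -> W) y x v :
  'D_v (fun x => Psi (row_mx y x)) x = 'D_(row_mx 0 v) Psi (row_mx y x).
Proof.
rewrite /derive; set a := (fun h => _); set b := (fun h => _).
suff -> : a = b by [].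
apply/funext => s; rewrite /a /b /=.
by rewrite scale_row_mx add_row_mx scaler0 add0r.
Qed.

(** Derivatives in [x] are derivatives of [Psi] in the directions [row_mx 0 v], hence again of the
    same form, and their continuity in [t] comes from that of [kap]. With [kap] a chart of the
    group, smoothness in product charts becomes the parametrized notion. *)
Lemma Ckpar_row_mx (m k : nat) (Om : set 'rV[R]_(m + n))
  (Psi : 'rV[R]_(m + n) -> R)
    (kap : T -> 'rV[R]_m) A :
  (forall p, A p -> {for p.1, continuous kap}) ->
  (forall p, A p -> Om (row_mx (kap p.1) p.2)) ->
  Ck k Om Psi -> Ckpar k A (fun t x => Psi (row_mx (kap t) x)).
Proof.
move=> ckap AOm.
have row_cont p : A p -> {for p, continuous (fun q => row_mx (kap q.1) q.2)}.
  move=> Ap; rewrite /prop_for /continuous_at (row_mx_affine (kap p.1)).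
  rewrite (_ : (fun q : T * 'rV[R]_n => _) = (fun q => row_mx (kap q.1) 0) +
      (fun q : T * 'rV[R]_n => row_mx 0 q.2)); last first.
    by apply/funext => z; rewrite row_mx_affine.
  apply: cvgD.
    apply: (@continuous_comp _ _ _ (fun q : T * 'rV[R]_n => kap q.1)
      (fun y => row_mx y (0 : 'rV[R]_n))); last first.
      by apply: mx_linear_continuous; exact: row_mx_linear_l.
    by apply: (@continuous_comp _ _ _ (@fst T 'rV[R]_n) kap p);
      [exact: cvg_fst|exact: ckap].
  apply: (@continuous_comp _ _ _ (@snd T 'rV[R]_n)
    (fun x => row_mx (0 : 'rV[R]_m) x) p); first exact: cvg_snd.
  by apply: mx_linear_continuous; exact: row_mx_linear_r.
have cont (j : nat) (f : 'rV[R]_(m + n) -> R) : Ck j Om f ->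
    forall p, A p -> {for p, continuous (fun q => f (row_mx (kap q.1) q.2))}.
  move=> Cf p Ap; apply: (@continuous_comp _ _ _
    (fun q => row_mx (kap q.1) q.2) f p).
    exact: row_cont.
  by apply: (Ck_continuous Cf); exact: AOm.
elim: k Psi => [|k IH] Psi CP; split; try exact: (cont _ _ CP); first by [].
case: CP => dP DP; split=> [p Ap|v].
  apply: (@differentiable_comp _ _ _ _ (fun x => row_mx (kap p.1) x) Psi).
    exact: row_mx_differentiable_r.
  by apply: dP; exact: AOm.
have := IH _ (DP (row_mx 0 v)); congr (Ckpar k A _).
by apply/funext => t; apply/funext => x; rewrite derive_row_mx_r.
Qed.

End ParametrizedCk.

Lemma unif_continuous_param (R : realType) (T U : topologicalType)
  (F : T -> U -> R) K x0 :
  compact K -> (forall t, K t ->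
    {for (t, x0), continuous (fun q => F q.1 q.2)}) ->
  forall e : R, 0 < e -> \forall x \near x0, forall t, K t ->
    `|F t x - F t x0| <= e.
Proof.
move=> /compact_near_coveringP cK cF e e0.
apply: (cK _ (nbhs x0) (fun x t => `|F t x - F t x0| <= e)) => t Kt.
have e2 : 0 < e / 2 by rewrite divr_gt0.
have /cvgrPdist_lt /(_ _ e2) [[A B] [/= At Bx] hAB] := cF t Kt.
exists (A, B) => // -[t' x] /= [At' Bx'].
have h1 := hAB (t', x) (conj At' Bx').
have h2 := hAB (t', x0) (conj At' (nbhs_singleton Bx)).
rewrite -[_ - F t' x0](subrKA (F t x0)); apply: (le_trans (ler_normD _ _)).
rewrite (splitr e); apply: lerD; last exact: ltW.
by rewrite distrC ltW.
Qed.

(** * Differentiation under the functional *)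

Section SmoothUnderFunctional.
Context {R : realType} {m n : nat} {G : lieGroupType R m}.
Variable J : (G -> R) -> R.
Hypothesis JD : forall f g, Cc f -> Cc g -> J (f \+ g) = J f + J g.
Hypothesis JZ : forall c f, Cc f -> J (fun x => c * f x) = c * J f.
Hypothesis Jbd : forall K, compact K -> exists2 C, 0 <= C & forall u B, Cc u ->
  vanishes_off K u -> (forall x, `|u x| <= B) -> `|J u| <= C * B.
Variable U : set 'rV[R]_n.
Hypothesis oU : open U.

(** One compact set has to serve all [x] near [x0], so that [Jbd] gives a single constant for all
    differences formed near [x0]. *)
Definition locally_supported (F : G -> 'rV[R]_n -> R) := forall x0, U x0 ->
  exists2 K, compact K & \forall x \near x0, vanishes_off K (F^~ x).

Lemma locally_supported_derive F v : locally_supported F ->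
  locally_supported (fun g x => 'D_v (F g) x).
Proof.
move=> sF x0 /sF [K cK hK]; exists K => //.
apply: filterS (nbhs_interior hK) => x hx g nKg.
rewrite (@near_eq_derive _ _ _ (F g) (cst 0)) ?derive_cst //.
by apply: filterS hx => y /(_ g nKg).
Qed.

Lemma J_sub f g : Cc f -> Cc g -> J (fun x => f x - g x) = J f - J g.
Proof.
move=> cf cg; have -> : (fun x => f x - g x) = f \+ (fun x => -1 * g x).
  by apply/funext => x; rewrite /= mulN1r.
by rewrite JD ?JZ ?mulN1r //; exact: Cc_scale.
Qed.

Lemma Cc_sub f g : Cc f -> Cc g -> Cc (fun x : G => f x - g x).
Proof.
move=> cf cg; have := Cc_add cf (Cc_scale (-1) cg); congr Cc.
by apply/funext => x; rewrite /= mulN1r.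
Qed.

Lemma slice_Cc F x : locally_supported F ->
  (forall p, (setT `*` U) p -> {for p, continuous (fun q => F q.1 q.2)}) ->
  U x -> Cc (F^~ x).
Proof.
move=> sF cF Ux; split.
  move=> g; apply: (@continuous_comp _ _ _ (fun g => (g,
    x)) (fun q => F q.1 q.2)).
    exact: pairr_continuous.
  exact: cF.
by have [K cK hK] := sF _ Ux; exists K => //; exact: nbhs_singleton hK.
Qed.

Lemma J_continuous F : locally_supported F ->
  (forall p, (setT `*` U) p -> {for p, continuous (fun q => F q.1 q.2)}) ->
  forall x, U x -> {for x, continuous (fun x => J (F^~ x))}.
Proof.
move=> sF cF x0 Ux0; have [K cK hK] := sF _ Ux0.
have [C C0 hC] := Jbd cK.
suff h : forall e : R, 0 < e ->
  \forall x \near x0, `|J (F^~ x0) - J (F^~ x)| <= e.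
  by have /cvgrPdist_le := h.
move=> e e0; have eC : 0 < e / (C + 1) by rewrite divr_gt0 // ltr_wpDl.
have hF : \forall x \near x0, forall g, K g -> `|F g x - F g x0| <= e / (C + 1).
  by apply: (unif_continuous_param cK) => // g Kg; exact: cF.
near=> x.
have Ux : U x by near: x; exact: (open_nbhs_nbhs (conj oU Ux0)).
have xK : vanishes_off K (F^~ x) by near: x.
have x0K : vanishes_off K (F^~ x0) by exact: nbhs_singleton hK.
have Fx : forall g, K g -> `|F g x - F g x0| <= e / (C + 1) by near: x.
have cx := slice_Cc sF cF Ux; have cx0 := slice_Cc sF cF Ux0.
rewrite distrC -J_sub //.
apply: (le_trans (hC _ (e / (C + 1)) _ _ _)).
- exact: Cc_sub.
- by move=> g nKg; rewrite xK // x0K // subrr.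
- move=> g; have [/Fx//|nKg] := pselect (K g).
  by rewrite xK // x0K // subrr normr0 ltW.
- by rewrite mulrA ler_pdivrMr ?ltr_wpDl // mulrC ler_wpM2l ?ltW // ltrDl.
Unshelve. all: by end_near. Qed.

(** The first-order error at [x0], as a function of [g], vanishes off [K]. By the mean value theorem
    it is a difference of derivatives at [x0] and at a point of the segment that depends on [g];
    uniform continuity over [K] makes it small compared with [|h|] uniformly in [g], and boundedness
    of [J] transfers the estimate. *)
Lemma J_derive F : locally_supported F -> Ckpar 1 (setT `*` U) F ->
  forall x, U x -> differentiable (fun x => J (F^~ x)) x /\
    forall v, 'D_v (fun x => J (F^~ x)) x = J (fun g => 'D_v (F g) x).
Proof.
move=> sF [cF [dF DF]] x0 Ux0.
pose D v g x := 'D_v (F g) x.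
have sD v : locally_supported (D v) by exact: locally_supported_derive.
have cD v : forall p, (setT `*` U) p ->
  {for p, continuous (fun q => D v q.1 q.2)}.
  by case: (DF v).
have [K cK hK] := sF _ Ux0; have [C C0 hC] := Jbd cK.
have ccD v x : U x -> Cc ((D v)^~ x) by exact: (slice_Cc (sD v) (cD v)).
have DE g x v : U x -> D v g x = \sum_i v 0 i * D (delta_mx 0 i) g x.
  by move=> Ux; rewrite /D derive_row_sum //; exact: (dF (g, x) (conj I Ux)).
have linL : linear (fun v => J ((D v)^~ x0)).
  move=> a u v; have := JD (Cc_scale a (ccD u _ Ux0)) (ccD v _ Ux0).
  rewrite JZ; last exact: ccD.
  move=> JE; apply: etrans JE.
  congr J; apply/funext => g /=.
  by rewrite /D derive_linear_in //; exact: (dF (g, x0) (conj I Ux0)).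
pose k := \sum_i \sum_j `|J ((D (delta_mx (i : 'I_1) (j : 'I_n)))^~ x0)|.
have Lk h : `|J ((D h)^~ x0)| <= k * `|h|.
  pose L : {linear 'rV[R]_n -> R} := HB.pack (fun v => J ((D v)^~ x0))
    (GRing.isLinear.Build _ _ _ _ _ linL).
  exact: (mx_linear_lipschitz L h).
apply: (differentiable_of_linear_approx linL Lk) => e e0.
(* The factor [n] counts the coordinate directions into which [h] is expanded, [C] is the bound of
   [J] over [K], and the summand 1 keeps the denominator positive. *)
pose e' := e / (C * n%:R + 1).
have Cn : 0 < C * n%:R + 1 by rewrite ltr_wpDl // mulr_ge0.
have e'0 : 0 < e' by rewrite divr_gt0.
have near0 : \forall x \near x0, [/\ U x, vanishes_off K (F^~ x) &
    forall i g, K g -> `|D (delta_mx 0 i) g x - D (delta_mx 0 i) g x0| <= e'].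
  have hD : \forall x \near x0, forall i, forall g, K g ->
      `|D (delta_mx 0 i) g x - D (delta_mx 0 i) g x0| <= e'.
    have hi i : \forall x \near x0, forall g, K g ->
        `|D (delta_mx 0 i) g x - D (delta_mx 0 i) g x0| <= e'.
      by apply: (unif_continuous_param cK) => // g Kg; exact: cD.
    exact: (filter_forall _ hi).
  near=> x; split; near: x => //.
  exact: (open_nbhs_nbhs (conj oU Ux0)).
have [r r0 hr] : exists2 r : R, 0 < r & forall x, `|x - x0| < r ->
    [/\ U x, vanishes_off K (F^~ x) &
    forall i g, K g -> `|D (delta_mx 0 i) g x - D (delta_mx 0 i) g x0| <= e'].
  have /nbhs_ballP [r r0 hr] := near0; exists r => // x xr; apply: hr.
  by rewrite -ball_normE /= distrC.
apply/nbhs_ballP; exists r => //= h; rewrite -ball_normE /= sub0r normrN => hr'.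
have [Uh hK' _] : [/\ U (x0 + h), vanishes_off K (F^~ (x0 + h))
  & forall i g, K g ->
    `|D (delta_mx 0 i) g (x0 + h) - D (delta_mx 0 i) g x0| <= e'].
  by apply: hr; rewrite addrC addKr.
have x0K : vanishes_off K (F^~ x0) by exact: nbhs_singleton hK.
have c1 := slice_Cc sF cF Uh; have c0 := slice_Cc sF cF Ux0.
have cd := Cc_sub c1 c0.
rewrite -J_sub // -J_sub //; last exact: ccD.
have DK : vanishes_off K ((D h)^~ x0).
  move=> g nKg; rewrite /D (@near_eq_derive _ _ _ (F g) (cst 0)) ?derive_cst //.
  by apply: filterS hK => y /(_ g nKg).
apply: (le_trans (hC _ (n%:R * e' * `|h|) _ _ _)).
- by apply: Cc_sub => //; exact: ccD.
- by move=> g nKg; rewrite hK' // x0K // DK // !subr0.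
- move=> g; have [Kg|nKg] := pselect (K g); last first.
    by rewrite hK' // x0K // DK // !subr0 normr0 mulr_ge0 // mulr_ge0 // ltW.
  have inball (t : R) : 0 <= t <= 1 -> `|x0 + t *: h - x0| < r.
    move=> /andP[t0 t1]; rewrite addrC addKr normrZ ger0_norm //.
    by apply: le_lt_trans hr'; rewrite ler_piMl.
  have [t t01 ->] := @line_MVT _ _ (F g) x0 h (fun t ht =>
    let: And3 Ut _ _ := hr _ (inball t ht) in dF (g, x0 + t *: h) (conj I Ut)).
  have [Ut _ hD] := hr _ (inball t t01).
  rewrite -[X in `|X - _|]/(D h g _) DE // [D h g x0]DE // -sumrB.
  apply: (le_trans (ler_norm_sum _ _ _)).
  rewrite -mulrA mulr_natl -[X in _ *+ X]card_ord -sumr_const.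
  apply: ler_sum => i _; rewrite -mulrBr normrM mulrC.
  by apply: ler_pM => //; [exact: hD|exact: mx_entry_le_norm].
- rewrite !mulrA; apply: ler_wpM2r => //.
  by rewrite /e' ?mulrA ler_pdivrMr // mulrC ler_wpM2l ?ltW // ltrDl.
Unshelve. all: by end_near. Qed.

Lemma Ck_functional k F : locally_supported F -> Ckpar k (setT `*` U) F ->
  Ck k U (fun x => J (F^~ x)).
Proof.
elim: k F => [|k IH] F sF CF.
  by apply: J_continuous => //; exact: Ckpar_continuous CF.
have C1 : Ckpar 1 (setT `*` U) F.
  case: CF => cF [dF DF]; split=> //; split=> // v.
  by split=> //; exact: Ckpar_continuous (DF v).
case: CF => cF [dF DF].
split; first by move=> x Ux; case: (J_derive sF C1 Ux).
move=> v; have Cv := IH _ (locally_supported_derive v sF) (DF v).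
by apply: (Ck_ext oU _ Cv) => x Ux; case: (J_derive sF C1 Ux).
Qed.

End SmoothUnderFunctional.

(** * Invariant functions of a proper action *)

Lemma open_preimage_on (T U : topologicalType) (f : T -> U) (A : set T)
  (D : set U) :
  open A -> (forall x, A x -> {for x, continuous f}) -> open D ->
  open (A `&` f @^-1` D).
Proof.
move=> oA cf oD; rewrite openE => x [Ax Dfx]; apply: filterI.
  exact: (open_nbhs_nbhs (conj oA Ax)).
exact: (cf x Ax _ (open_nbhs_nbhs (conj oD Dfx))).
Qed.

Lemma continuous_pair_at (T U V : topologicalType) (f : T -> U) (g : T -> V) x :
  {for x, continuous f} -> {for x, continuous g} ->
  {for x, continuous (fun y => (f y, g y))}.
Proof. by move=> cf cg; exact: cvg_pair. Qed.

Lemma open_setX (T U : topologicalType) (A : set T) (B : set U) :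
  open A -> open B -> open (A `*` B).
Proof.
move=> oA oB; rewrite openE => -[x y] [/= Ax By].
by exists (A, B) => //; split; apply: open_nbhs_nbhs.
Qed.

Lemma Ck_mx_entry (R : realType) (V : normedModType R) p q k (A : set V)
    (f : V -> 'M[R]_(p, q)) i j : open A -> Ck k A f ->
      Ck k A (fun x => f x i j).
Proof.
move=> oA Cf.
have lin : linear (fun x : 'M[R]_(p, q) => x i j : R) by move=> a u v;
  rewrite !mxE.
pose L : {linear 'M[R]_(p, q) -> R} :=
  HB.pack (fun x : 'M[R]_(p, q) => x i j : R)
  (GRing.isLinear.Build _ _ _ _ _ lin).
have cL : continuous L by exact: (mx_linear_continuous lin).
exact: (Ck_linear_comp oA cL Cf).
Qed.

Section Separation.
Context {R : realType} {m n : nat} {G : lieGroupType R m}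
  {M : manifoldType R n}.
Variable a : G -> M -> M.
Hypothesis a_action : smooth_action a.
Hypothesis a_proper : proper_action a.

Lemma action_continuous : continuous (fun p : G * M => a p.1 p.2).
Proof. by case: a_action => _ _ []. Qed.

(** The part of the orbit inside a compact neighbourhood [K] of [z] is the image under the action of
    the preimage of [K * {w}], which properness makes compact; hence it is closed. *)
Lemma orbit_complement_nbhs w z : ~ action_orbit a w z -> nbhs z
  (~` action_orbit a w).
Proof.
move=> nwz; have [K [cK _ zK]] := manifold_compact_nbhs (@filterT _ (nbhs z) _).
pose S := [set x : G * M | (K `*` [set w]) (a x.1 x.2, x.2)].
have cS : compact S by apply: a_proper; apply: compact_setX => //;
  exact: compact_set1.
pose C := [set a x.1 x.2 | x in S].
have cC : compact C.
  apply: continuous_compact => //; apply: continuous_subspaceT.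
  exact: action_continuous.
have oC : open (~` C).
  by apply: closed_openC; apply: compact_closed => //;
    exact: manifold_hausdorff.
have nC : ~ C z.
  by move=> [[g p] /= [_ /= ->] gz]; apply: nwz; exists g.
apply: filterS (filterI zK (open_nbhs_nbhs (conj oC nC))) => p [Kp nCp]
  [g _ gp].
by apply: nCp; exists (g, w) => //; split => //=; rewrite gp.
Qed.

Section Average.
Variables (z : M) (e : R).
Let d := chart_at z.
Hypothesis e0 : 0 < e.
Hypothesis ball_cod : forall x, `|x - chart_map d z| <= e -> chart_cod d x.

(** The norm on row vectors is the sup norm, which is not smooth; the squared Euclidean distance is,
    and its ball of radius [e] lies in the sup ball of the same radius. *)
Definition bump_rV (y : 'rV[R]_n) : R :=
  flat 1 (e ^+ 2 - \sum_i (y 0 i - chart_map d z 0 i) ^+ 2).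

Definition bump (q : M) : R :=
  if pselect (chart_dom d q) then bump_rV (chart_map d q) else 0.

Let K0 := [set chart_inv d x | x in [set x | `|x - chart_map d z| <= e]].

Lemma bump_supp_compact : compact K0.
Proof. exact: chart_ball_compact. Qed.

Lemma bump_off q : ~ K0 q -> bump q = 0.
Proof.
move=> nK; rewrite /bump; case: pselect => [dq|//]; apply: flat_le0.
have : ~ `|chart_map d q - chart_map d z| <= e.
  by move=> h; apply: nK; exists (chart_map d q) => //; exact: chart_mapK.
move/negP; rewrite -ltNge [X in e < X]/Num.Def.normr /= mx_normrE.
move=> /bigmax_gtP; rewrite ltNge (ltW e0) /= => -[//|[[i0 i] _ /=]].
rewrite ord1 !mxE => hi; rewrite subr_le0 (bigD1 i) //=.
apply: (@le_trans _ _ ((chart_map d q 0 i - chart_map d z 0 i) ^+ 2)).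
  rewrite -[leRHS]real_normK ?num_real // ler_sqr ?nnegrE ?(ltW e0) //.
  exact: ltW.
by rewrite lerDl; apply: sumr_ge0 => j _; rewrite sqr_ge0.
Qed.

Lemma bump_ge0 q : 0 <= bump q.
Proof. by rewrite /bump; case: pselect => [?|//]; exact: flat1_ge0. Qed.

Lemma bump_center : 0 < bump z.
Proof.
rewrite /bump; case: pselect => [?|nz]; last by case: nz; exact: chart_at_dom.
apply: flat1_gt0; rewrite big1 ?subr0 ?exprn_gt0 // => i _.
by rewrite subrr expr0n.
Qed.

Lemma Ck_bump_rV k (V : normedModType R) (A : set V) (f : V -> 'rV[R]_n) :
  open A ->
  Ck k A f -> Ck k A (fun x => bump_rV (f x)).
Proof.
move=> oA Cf; apply: (Ck_flat (q :=
  fun x => e ^+ 2 - \sum_i (f x 0 i - chart_map d z 0 i) ^+ 2)) => //.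
have Ci i : Ck k A (fun x => (f x 0 i - chart_map d z 0 i) ^+ 2).
  have C1 : Ck k A (fun x => f x 0 i - chart_map d z 0 i).
    by apply: Ck_add => //; [exact: Ck_mx_entry|exact: Ck_cst].
  by apply: (Ck_ext oA _ (Ck_mul oA C1 C1)) => x _; rewrite expr2.
apply: (Ck_add oA (Ck_cst k A (e ^+ 2))).
have := Ck_mul oA (Ck_cst k A (-1 : R)) (Ck_sum (index_enum 'I_n) oA Ci).
by apply: Ck_ext => // x _; rewrite /cst mulN1r.
Qed.

(** Where [g0] moves the point into the domain of [d], the bump is its coordinate formula composed
    with the action in product charts. Elsewhere the image avoids the closed set [K0], and the
    function is zero nearby. *)
Lemma Ckpar_bump_action k (c : chart R n M) : atlas c ->
  Ckpar k (setT `*` chart_cod c) (fun g x => bump (a g (chart_inv c x))).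
Proof.
move=> ac; apply: Ckpar_local => -[g0 x0] [_ /= cx0].
have a_inv_cont (p : G * 'rV[R]_n) : (setT `*` chart_cod c) p ->
    {for p, continuous (fun p : G * 'rV[R]_n => a p.1 (chart_inv c p.2))}.
  move=> [_ cp]; apply: (@continuous_comp _ _ _ (fun p : G * 'rV[R]_n => (p.1,
    chart_inv c p.2))
    (fun p => a p.1 p.2) p); last exact: action_continuous.
  apply: continuous_pair_at; first exact: cvg_fst.
  apply: (@continuous_comp _ _ _ snd (chart_inv c) p); first exact: cvg_snd.
  exact: chart_inv_continuous_at.
have oTc : open ((setT : set G) `*` chart_cod c).
  by apply: open_setX; [exact: openT|exact: chart_cod_open].
have [dq|ndq] := pselect (chart_dom d (a g0 (chart_inv c x0))); last first.
  have oK : open (~` K0).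
    apply: closed_openC; apply: compact_closed; first exact: manifold_hausdorff.
    exact: bump_supp_compact.
  exists ((setT `*` chart_cod c) `&` (fun p => a p.1 (chart_inv c p.2)) @^-1`
    (~` K0)).
  split.
    split=> //= -[x /ball_cod cx E]; apply: ndq; rewrite -E.
    exact: chart_inv_dom.
  apply: (Ckpar_ext (F := fun _ _ => 0));
    [exact: open_preimage_on| |exact: Ckpar0].
  by move=> [g x] [_ /= nK]; rewrite bump_off.
pose c1 := chart_at g0.
pose Th (y : 'rV[R]_(m + n)) :=
  a (chart_inv c1 (lsubmx y)) (chart_inv c (rsubmx y)).
pose Om := [set y | [/\ chart_cod c1 (lsubmx y), chart_cod c (rsubmx y)
                         & chart_dom d (Th y)]].
have CTh : Ck k Om (chart_map d \o Th).
  case: a_action => _ _ [_ sm].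
  exact: (sm c1 c d (chart_at_atlas g0) ac (chart_at_atlas z) k).
have oOm : open Om.
  pose A0 := [set y : 'rV[R]_(m + n) | chart_cod c1 (lsubmx y)] `&`
             [set y : 'rV[R]_(m + n) | chart_cod c (rsubmx y)].
  have -> : Om = A0 `&` Th @^-1` chart_dom d.
    by apply/seteqP; split=> [y [? ? ?]|y [[? ?] ?]].
  apply: open_preimage_on; last exact: chart_dom_open.
    apply: openI.
      apply: open_comp; last exact: chart_cod_open.
      by move=> y _; exact: continuous_lsubmx.
    apply: open_comp; last exact: chart_cod_open.
    by move=> y _; exact: continuous_rsubmx.
  move=> y [/= h1 h2].
  apply: (@continuous_comp _ _ _ (fun y : 'rV[R]_(m + n) =>
      (chart_inv c1 (lsubmx y), chart_inv c (rsubmx y))) (fun p => a p.1 p.2)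
        y);
    last exact: action_continuous.
  apply: continuous_pair_at.
    apply: (@continuous_comp _ _ _ (fun y : 'rV[R]_(m + n) => lsubmx y)
      (chart_inv c1) y).
      exact: continuous_lsubmx.
    exact: chart_inv_continuous_at.
  apply: (@continuous_comp _ _ _ (fun y : 'rV[R]_(m + n) => rsubmx y)
    (chart_inv c) y).
    exact: continuous_rsubmx.
  exact: chart_inv_continuous_at.
pose B0 := chart_dom c1 `*` chart_cod c.
have oB0 : open B0 by apply: open_setX;
  [exact: chart_dom_open|exact: chart_cod_open].
exists (B0 `&` (fun p => a p.1 (chart_inv c p.2)) @^-1` chart_dom d); split.
  by split=> //; split=> //; exact: chart_at_dom.
have oB : open (B0 `&` (fun p => a p.1 (chart_inv c p.2)) @^-1` chart_dom d).
  apply: open_preimage_on => //; last exact: chart_dom_open.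
  by move=> p [_ ?]; exact: a_inv_cont.
have ThE g x : chart_dom c1 g ->
  Th (row_mx (chart_map c1 g) x) = a g (chart_inv c x).
  by move=> cg; rewrite /Th row_mxKl row_mxKr chart_mapK.
apply: (Ckpar_ext (F := fun g x => bump_rV
  (chart_map d (Th (row_mx (chart_map c1 g) x))))) => //.
  by move=> [g x] [[/= cg cx] dp]; rewrite ThE // /bump; case: pselect.
apply: (Ckpar_row_mx (Om := Om) (Psi := fun y => bump_rV (chart_map d (Th y)))).
- by move=> p [[cg _] _]; exact: chart_map_continuous_at.
- by move=> [g x] [[/= cg cx] dp]; split;
  rewrite ?ThE // ?row_mxKl ?row_mxKr //; exact: chart_map_cod.
- exact: (Ck_bump_rV oOm CTh).
Qed.

(** For points of a compact neighbourhood [N], the elements that move them into [K0] lie in the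
    projection to the group of the preimage of [K0 * N], which is compact by properness. *)
Lemma bump_action_supported (c : chart R n M) :
  locally_supported (chart_cod c) (fun (g : G) x => bump (a g (chart_inv c x))).
Proof.
move=> x0 cx0.
have [N [cN _ nN]] := manifold_compact_nbhs
  (@filterT _ (nbhs (chart_inv c x0)) _).
pose S := [set p : G * M | (K0 `*` N) (a p.1 p.2, p.2)].
have cS : compact S.
  by apply: a_proper; apply: compact_setX => //; exact: bump_supp_compact.
exists [set p.1 | p in S].
  by apply: continuous_compact => //; apply: continuous_subspaceT => p;
    exact: cvg_fst.
have nearN : \forall x \near x0, N (chart_inv c x).
  exact: (chart_inv_continuous_at cx0 nN).
apply: filterS nearN => x Nx g nS; apply: bump_off => K0g.
by apply: nS; exists (g, chart_inv c x).
Qed.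

End Average.

Theorem invariant_smooth_separation w z : ~ action_orbit a w z ->
  exists f : M -> R, [/\ smooth_fun f, forall g p, f (a g p) = f p
    & f z <> f w].
Proof.
move=> /orbit_complement_nbhs zU.
have [J [JD JZ Jt Jpos Jbd]] := @haar_functional R m G.
pose d := chart_at z.
have [e e0 he] := chart_ball (chart_at_dom z) zU.
have ball_cod x : `|x - chart_map d z| <= e -> chart_cod d x by move=> /he [].
pose u p g := bump z e (a g p).
have supported (c : chart R n M) : locally_supported (chart_cod c)
  (fun g x => u (chart_inv c x) g).
  exact: (@bump_action_supported z e e0 ball_cod c).
have cu p : Cc (u p).
  have cp : chart_cod (chart_at p) (chart_map (chart_at p) p).
    by apply: chart_map_cod; exact: chart_at_dom.
  have C0 : Ckpar 0 (setT `*` chart_cod (chart_at p))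
      (fun g x => u (chart_inv (chart_at p) x) g).
    by apply: Ckpar_bump_action => //; exact: chart_at_atlas.
  have := slice_Cc (supported (chart_at p)) (Ckpar_continuous C0) cp.
  by rewrite chart_mapK //; exact: chart_at_dom.
exists (fun p => J (u p)); split.
- move=> c ac k.
  apply: (Ck_functional JD JZ Jbd (@chart_cod_open _ _ _ c)
    (F := fun g x => u (chart_inv c x) g)).
    exact: supported.
  exact: Ckpar_bump_action.
(* Acting first by [h] and then by [g] is acting by [g * h], so passing from [p] to [a h p]
   right-translates [u p] by [h]. *)
- move=> h p; rewrite -[RHS](Jt h) //; congr J; apply/funext => g.
  by rewrite /u; case: a_action => _ -> _.
- have -> : J (u w) = 0.
    have -> : u w = (fun g => 0 * u w g).
      apply/funext => g; rewrite mul0r /u bump_off // => -[x /he [_ no] E].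
      by apply: no; exists g.
    by rewrite JZ ?mul0r.
  apply/eqP; rewrite gt_eqF //; apply: (Jpos _ 1%g).
    by split=> // g; exact: bump_ge0.
  rewrite /u; case: a_action => -> _ _; exact: bump_center.
Qed.

End Separation.

(** * Moment maps *)

Lemma connected_locally_constant (T : topologicalType) (S : Type) (u : T -> S) :
  connected [set: T] -> (forall x, \forall y \near x, u y = u x) ->
  forall x y, u x = u y.
Proof.
move=> cT loc x y.
have op (P : set S) : open (u @^-1` P).
  by rewrite openE => q Pq; apply: filterS (loc q) => q' /= ->.
have E : [set q | u q = u x] = setT.
  apply: cT; first by exists x.
    by exists [set q | u q = u x];
      [exact: (op [set s | s = u x])|rewrite setTI].
  exists [set q | u q = u x]; last by rewrite setTI.
  by rewrite -[[set q | _]]setCK; apply: open_closedC;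
    exact: (op [set s | s <> u x]).
by have : [set q | u q = u x] y by rewrite E.
Qed.

(** Balls in a chart are convex, so the mean value theorem along segments gives local constancy, and
    connectedness does the rest. *)
Lemma derive0_constant (R : realType) (n : nat) (M : manifoldType R n)
  (u : M -> R) :
  connected [set: M] ->
  (forall (p : M) x, chart_cod (chart_at p) x ->
     differentiable (u \o chart_inv (chart_at p)) x /\
     forall v, 'D_v (u \o chart_inv (chart_at p)) x = 0) ->
  forall p q, u p = u q.
Proof.
move=> cM du; apply: connected_locally_constant => // p.
pose c := chart_at p; have cp : chart_dom c p := chart_at_dom p.
have [e e0 he] := chart_ball cp (@filterT _ (nbhs p) _).
have near_p : \forall q \near p,
  chart_dom c q /\ `|chart_map c q - chart_map c p| < e.
  near=> q; split; near: q; first exact: chart_dom_nbhs.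
  have /cvgrPdist_lt /(_ e e0) := chart_map_continuous_at cp.
  by apply: filterS => q; rewrite distrC.
apply: filterS near_p => q [cq qe].
rewrite -(chart_mapK cq) -(chart_mapK cp); apply/eqP; rewrite -subr_eq0;
  apply/eqP.
set x := chart_map c p; set h := chart_map c q - x.
have inball (t : R) : 0 <= t <= 1 -> chart_cod c (x + t *: h).
  move=> /andP[t0 t1]; apply: (he _ _).1;
    rewrite addrC addKr normrZ ger0_norm //.
  by apply: le_trans (ltW qe); rewrite ler_piMl.
have [t t01] := @line_MVT _ _ (u \o chart_inv c) x h
  (fun t ht => (du p _ (inball t ht)).1).
by rewrite (du p _ (inball t t01)).2 /= [x + h]addrC subrK.
Unshelve. all: by end_near. Qed.

Lemma smooth_map2_slice_l (R : realType) (m1 m2 n : nat)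
  (M1 : manifoldType R m1)
    (M2 : manifoldType R m2) (N : manifoldType R n) (f : M1 -> M2 -> N)
    (c : chart R m1 M1) (d : chart R n N) p q : smooth_map2 f -> atlas c ->
      atlas d ->
  chart_dom c p -> chart_dom d (f p q) ->
  differentiable (chart_map d \o f^~ q \o chart_inv c) (chart_map c p).
Proof.
move=> [_ sm] ac ad cp dfpq; pose c2 := chart_at q;
  have cq : chart_dom c2 q := chart_at_dom q.
have [df _] := sm c c2 d ac (chart_at_atlas q) ad 1%N.
rewrite (_ : _ \o _ = (chart_map d \o (fun x : 'rV[R]_(m1 + m2) =>
    f (chart_inv c (lsubmx x)) (chart_inv c2 (rsubmx x)))) \o
    (fun y => row_mx y (chart_map c2 q))); last first.
  by apply/funext => y /=; rewrite row_mxKl row_mxKr chart_mapK.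
apply: differentiable_comp; first exact: row_mx_differentiable_l.
by apply: df; split; rewrite ?row_mxKl ?row_mxKr ?chart_mapK //;
  exact: chart_map_cod.
Qed.

(** * Derivatives along fundamental vector fields *)

Section FundamentalField.
Context {R : realType} {m n : nat} {G : lieGroupType R m}
  {M : manifoldType R n}.
Variable a : G -> M -> M.
Hypothesis a_action : smooth_action a.
Let c1 := chart_at (1%g : G).

Lemma action_continuous_l p : continuous (a^~ p).
Proof.
move=> g; apply: (@continuous_comp _ _ _ (fun g => (g,
  p)) (fun x => a x.1 x.2)).
  exact: pairr_continuous.
exact: action_continuous.
Qed.

Lemma derive_along_action (f : M -> R) p : smooth_fun f ->
  differentiable (f \o a^~ p \o chart_inv c1) (chart_map c1 1%g) /\
  forall xi, 'D_xi (f \o a^~ p \o chart_inv c1) (chart_map c1 1%g) =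
    dfun f p (fundamental_vf a xi p).
Proof.
move=> sf; have [act1 _ sm] := a_action.
(* The coordinates of [fundamental_vf] refer to the chart at [a 1 p], a point equal to [p] only
   propositionally. The computation stays in that chart until [act1] is rewritten at the very
   end. *)
pose e := chart_at (a 1%g p); have ep : chart_dom e (a 1%g p) := chart_at_dom _.
have cod1 : chart_cod c1 (chart_map c1 1%g) by apply: chart_map_cod;
  exact: chart_at_dom.
pose psi := chart_map e \o a^~ p \o chart_inv c1.
have dpsi : differentiable psi (chart_map c1 1%g).
  apply: (smooth_map2_slice_l sm (chart_at_atlas _) (chart_at_atlas _) _ ep).
  exact: chart_at_dom.
have psi1 : psi (chart_map c1 1%g) = chart_map e (a 1%g p).
  by rewrite /psi /= chart_mapK //; exact: chart_at_dom.
have df : differentiable (f \o chart_inv e) (psi (chart_map c1 1%g)).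
  rewrite psi1; have [df _] := sf e (chart_at_atlas _) 1%N.
  by apply: df; exact: chart_map_cod.
have E : \forall y \near chart_map c1 1%g,
    ((f \o chart_inv e) \o psi) y = (f \o a^~ p \o chart_inv c1) y.
  have cont : {for chart_map c1 1%g, continuous (a^~ p \o chart_inv c1)}.
    apply: continuous_comp; first exact: chart_inv_continuous_at.
    exact: action_continuous_l.
  have dome : nbhs ((a^~ p \o chart_inv c1) (chart_map c1 1%g)) (chart_dom e).
    by rewrite /= chart_mapK; [exact: chart_dom_nbhs|exact: chart_at_dom].
  have near_dom : \forall y \near chart_map c1 1%g,
    chart_dom e (a (chart_inv c1 y) p).
    exact: (cont _ dome).
  by apply: filterS near_dom => y ey; rewrite /psi /= chart_mapK.
split.
  by apply: near_eq_differentiable E _; exact: differentiable_comp.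
move=> xi; rewrite -(near_eq_derive _ E) derive_chain // psi1.
rewrite /dfun /fundamental_vf /tangent_map -/c1.
by rewrite -/psi /psi /e act1.
Qed.

Lemma invariant_dfun0 (f : M -> R) p xi : smooth_fun f ->
  (forall g q, f (a g q) = f q) -> dfun f p (fundamental_vf a xi p) = 0.
Proof.
move=> sf inv; rewrite -(derive_along_action p sf).2.
rewrite (_ : _ \o _ = cst (f p)) ?derive_cst //.
by apply/funext => y /=.
Qed.

(** Derivatives of the orbit map at [h] reduce to derivatives at 1: writing [y p] as
    [(y h^-1) (h p)] turns the function near [h] into the orbit function of the point [h p] near 1,
    where the fundamental fields compute it. *)
Lemma constant_on_orbits (f : M -> R) : connected [set: G] -> smooth_fun f ->
  (forall xi p, dfun f p (fundamental_vf a xi p) = 0) ->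
  forall g p, f (a g p) = f p.
Proof.
move=> cG sf df0 g p; have [act1 actM _] := a_action.
suff -> : f (a g p) = f (a 1%g p) by rewrite act1.
apply: (derive0_constant (u := fun g => f (a g p))) => // {}g x.
set c := chart_at g => cx; set h := chart_inv c x.
pose w := f \o a^~ (a h p) \o chart_inv c1.
pose kap := chart_map c1 \o (fun k : G => k * h^-1)%g \o chart_inv c.
have c1dom : chart_dom c1 1%g by exact: chart_at_dom.
have kapx : kap x = chart_map c1 1%g by rewrite /kap /= -/h mulgV.
have dkap : differentiable kap x.
  rewrite -(chart_invK cx); apply: (smooth_map2_slice_l (f :=
    fun x y : G => (x * y)%g)).
  - exact: mulg_smooth.
  - exact: chart_at_atlas.
  - exact: chart_at_atlas.
  - exact: chart_inv_dom.
  - by rewrite -/h mulgV.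
have [dw Dw] := derive_along_action (a h p) sf.
rewrite -/w -kapx in dw Dw.
have E : \forall y \near x,
  (w \o kap) y = ((fun g => f (a g p)) \o chart_inv c) y.
  have cont : {for x, continuous ((fun k : G => k * h^-1)%g \o chart_inv c)}.
    apply: continuous_comp; first exact: chart_inv_continuous_at.
    exact: mulgr_continuous.
  have dom1 : nbhs (((fun k : G => k * h^-1)%g \o chart_inv c) x)
    (chart_dom c1).
    by rewrite /= -/h mulgV; exact: chart_dom_nbhs.
  have near_dom : \forall y \near x, chart_dom c1 (chart_inv c y * h^-1)%g.
    exact: (cont _ dom1).
  apply: filterS near_dom => y ey.
  by rewrite /w /kap /= chart_mapK // -actM mulgVK.
split; first by apply: near_eq_differentiable E _; exact: differentiable_comp.
by move=> v; rewrite -(near_eq_derive _ E) derive_chain // Dw df0.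
Qed.

End FundamentalField.

(** * Poisson brackets with functions of a moment map *)

Section MomentMap.
Context {R : realType} {m n : nat} {G : lieGroupType R m}
  {M : manifoldType R n}.
Variables (omega : bilinear_field M) (a : G -> M -> M) (Phi : M -> lie_dual G).
Hypothesis omega_symplectic : symplectic_form omega.
Hypothesis Phi_moment : equivariant_moment_map omega a Phi.

Lemma pairingE (alpha : 'cV[R]_m) (xi : 'rV[R]_m) :
  pairing alpha xi = \sum_i xi 0 i * alpha i 0.
Proof. by rewrite /pairing mxE. Qed.

Lemma pairing_linear (xi : 'rV[R]_m) : linear ((@pairing R m)^~ xi).
Proof. by move=> k u v; rewrite /pairing linearP !mxE. Qed.

Lemma pairing_smooth (xi : 'rV[R]_m) : smooth_on setT ((@pairing R m)^~ xi).
Proof.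
move=> k; pose L : {linear 'cV[R]_m -> R} := HB.pack ((@pairing R m)^~ xi)
  (GRing.isLinear.Build _ _ _ _ _ (pairing_linear xi)).
have cL : continuous L by exact: (mx_linear_continuous (pairing_linear xi)).
exact: (Ck_linear k cL).
Qed.

Lemma moment_dfun_comp (h : 'cV[R]_m -> R) p v : differentiable h (Phi p) ->
  dfun (h \o Phi) p v = 'D_(dfun (Phi : M -> 'cV[R]_m) p v) h (Phi p).
Proof.
move=> dh; have cp : chart_dom (chart_at p) p := chart_at_dom p.
have [dPhi _] := moment_smooth Phi_moment (chart_at_atlas p) 1%N.
rewrite /dfun -[h \o Phi \o _]/(h \o (Phi \o chart_inv (chart_at p)))
  derive_chain /=.
- by rewrite chart_mapK.
- by apply: dPhi; exact: chart_map_cod.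
- by rewrite chart_mapK.
Qed.

(** The differential of [h] at [alpha] is a linear form on the dual of the Lie algebra; [pairing]
    identifies it with this element of the Lie algebra. *)
Definition gradient (h : 'cV[R]_m -> R) (alpha : 'cV[R]_m) : 'rV[R]_m :=
  \row_i 'D_(delta_mx i 0) h alpha.

(** At [p], [h \o Phi] has the same differential as the single component of [Phi] along [xi], the
    gradient frozen at [Phi p]. Its hamiltonian vector at [p] is therefore a fundamental vector. *)
Lemma dfun_moment_comp (h : 'cV[R]_m -> R) p v : smooth_on setT h ->
  dfun (h \o Phi) p v =
  omega (fundamental_vf a (gradient h (Phi p)) p) v.
Proof.
move=> sh; have dh : differentiable h (Phi p) by case: (sh 1%N) => dh _;
  exact: dh.
set xi := gradient _ _; rewrite -(moment_differential Phi_moment).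
rewrite moment_dfun_comp // -[fun y => _]/((@pairing R m)^~ xi \o Phi).
have dpair : differentiable ((@pairing R m)^~ xi) (Phi p).
  by apply: mx_linear_differentiable; exact: pairing_linear.
rewrite moment_dfun_comp //; set w := dfun _ p v.
have -> : 'D_w ((@pairing R m)^~ xi) (Phi p) = pairing w xi.
  exact: (mx_derive_linear _ _ (pairing_linear xi)).
rewrite deriveE // [w in LHS]matrix_sum_delta linear_sum pairingE.
apply: eq_bigr => i _; rewrite big_ord1 linearZ /= mxE deriveE //.
by rewrite mulrC.
Qed.

Lemma hamiltonian_vfE (f : M -> R) p (X : tangent p) :
  (forall v, omega X v = dfun f p v) -> hamiltonian_vf omega f p = X.
Proof.
move=> hX; have hY : forall v, omega (hamiltonian_vf omega f p) v = dfun f p v.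
  by have := @xgetPex _ 0 [set X : 'rV[R]_n | forall v : tangent p,
    omega X v = dfun f p v];
     apply; exists X.
apply/eqP; rewrite -subr_eq0; apply/eqP.
apply: (symplectic_nondegenerate omega_symplectic) => v.
have -> : hamiltonian_vf omega f p - X = -1 *: X + hamiltonian_vf omega f p.
  by rewrite scaleN1r addrC.
apply: (etrans (@symplectic_linear_l _ _ _ _ omega_symplectic p v (-1) X
  (hamiltonian_vf omega f p))).
by rewrite /= hX hY mulN1r addNr.
Qed.

(** The bracket is [omega] of the hamiltonian vector of [f] and a fundamental vector, that is, the
    derivative of [f] along the latter. *)
Lemma poisson_moment_comp (f : M -> R) (h : 'cV[R]_m -> R) p :
  smooth_on setT h ->
  (forall xi, dfun f p (fundamental_vf a xi p) = 0) ->
  poisson omega f (h \o Phi) p = 0.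
Proof.
move=> sh df0; rewrite /poisson.
have -> : hamiltonian_vf omega (h \o Phi) p = fundamental_vf a
  (gradient h (Phi p)) p.
  by apply: hamiltonian_vfE => v; rewrite dfun_moment_comp.
set X := fundamental_vf _ _ _.
rewrite /hamiltonian_vf; set S := [set X : 'rV[R]_n | _].
have [[Y SY]|nS] := pselect (exists Y, S Y).
  rewrite -[RHS](df0 (gradient h (Phi p))).
  exact: (xgetPex 0 (ex_intro _ Y SY)).
(* If no vector represents the differential of [f], the default value of [xget] is 0 and the bracket
   vanishes by linearity. This case split replaces the argument that a nondegenerate form represents
   every covector. *)
rewrite xgetPN; last by move=> Y SY; apply: nS; exists Y.
have := @symplectic_linear_l _ _ _ _ omega_symplectic p X (-1) (0 : 'rV[R]_n) 0.
by rewrite scaler0 addr0 /= => E; move: E; rewrite mulN1r addNr.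
Qed.

Lemma invariant_in_centralizer (f : M -> R) : smooth_action a -> smooth_fun f ->
  (forall g p, f (a g p) = f p) -> centralizer omega (moment_pullback Phi) f.
Proof.
move=> sa sf inv; split=> // _ [h sh <-] p; apply: poisson_moment_comp => // xi.
exact: invariant_dfun0.
Qed.

End MomentMap.

Lemma level_sets_are_orbits (R : realType) (n m1 m2 : nat)
  (M : manifoldType R n)
    (omega : bilinear_field M) (G1 : lieGroupType R m1) (G2 : lieGroupType R m2)
    (a1 : G1 -> M -> M) (a2 : G2 -> M -> M)
    (Phi1 : M -> lie_dual G1) (Phi2 : M -> lie_dual G2) :
  symplectic_form omega -> connected [set: G2] -> smooth_action a2 ->
    proper_action a2 ->
  equivariant_moment_map omega a1 Phi1 ->
    equivariant_moment_map omega a2 Phi2 ->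
  centralizer omega (moment_pullback Phi2) = moment_pullback Phi1 ->
  forall z, Phi1 @^-1` [set Phi1 z] = action_orbit a2 z.
Proof.
move=> om cG2 sa2 pa2 mom1 mom2 howe z; apply/seteqP; split=> p /=.
  move=> pz; apply: contrapT => /(invariant_smooth_separation sa2 pa2)
    [f [sf inv]]; apply.
  have := invariant_in_centralizer om mom2 sa2 sf inv.
  by rewrite howe => -[h _ <-]; rewrite /= pz.
move=> [g _ <-]; apply/matrixP => i j; rewrite (ord1 j).
pose eta : 'rV[R]_m1 := delta_mx 0 i.
have pairE (alpha : 'cV[R]_m1) : alpha i 0 = pairing alpha eta.
  by rewrite /pairing -rowE mxE.
rewrite !pairE.
have : moment_pullback Phi1 ((@pairing R m1)^~ eta \o Phi1).
  by exists ((@pairing R m1)^~ eta) => //; exact: pairing_smooth.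
rewrite -howe => -[sf comm].
apply: (constant_on_orbits sa2 cG2 sf) => xi q.
(* Both hamiltonian vectors are fundamental vectors, so the vanishing bracket of the components
   along [eta] and [xi] is the derivative of the former along the fundamental field of [xi]. *)
have := comm ((@pairing R m2)^~ xi \o Phi2) _ q.
rewrite /poisson.
rewrite (hamiltonian_vfE om (X := fundamental_vf a1 eta q)); last first.
  by move=> v; rewrite -(moment_differential mom1).
rewrite (hamiltonian_vfE om (X := fundamental_vf a2 xi q)); last first.
  by move=> v; rewrite -(moment_differential mom2).
rewrite -(moment_differential mom1); apply.
by exists ((@pairing R m2)^~ xi) => //; exact: pairing_smooth.
Qed.

Theorem proposition2p6 (R : realType) (n m1 m2 : nat) (M : manifoldType R n)
    (omega : bilinear_field M)
    (G1 : lieGroupType R m1) (G2 : lieGroupType R m2)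
    (a1 : G1 -> M -> M) (a2 : G2 -> M -> M)
    (Phi1 : M -> lie_dual G1) (Phi2 : M -> lie_dual G2)
    (M_connected : connected [set: M])
    (omega_symplectic : symplectic_form omega)
    (G1_connected : connected [set: G1])
    (G2_connected : connected [set: G2])
    (a1_action : smooth_action a1) (a2_action : smooth_action a2)
    (a1_proper : proper_action a1) (a2_proper : proper_action a2)
    (a1_a2_commute : forall (g : G1) (h : G2) (z : M),
       a1 g (a2 h z) = a2 h (a1 g z))
    (Phi1_moment : equivariant_moment_map omega a1 Phi1)
    (Phi2_moment : equivariant_moment_map omega a2 Phi2)
    (howe12 : centralizer omega (moment_pullback Phi1) = moment_pullback Phi2)
    (howe21 : centralizer omega (moment_pullback Phi2) = moment_pullback Phi1) :
  forall z : M,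
    Phi1 @^-1` [set Phi1 z] = action_orbit a2 z /\
    Phi2 @^-1` [set Phi2 z] = action_orbit a1 z.
Proof.
move=> z; split.
  exact: (level_sets_are_orbits omega_symplectic G2_connected a2_action
    a2_proper Phi1_moment Phi2_moment howe21).
exact: (level_sets_are_orbits omega_symplectic G1_connected a1_action
  a1_proper Phi2_moment Phi1_moment howe12).
Qed.
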